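(* Let $\eta_0$ be a horizontal domino with content set $\{0,1\}$ and $\eta_1$ a vertical domino with content set $\{0,1\}$. Let $m\ge1$ and $a=(a_1,\ldots,a_m)\in\{0,1\}^m$, and let $l$ be the number of entries of $a$ equal to $1$. (i) If $n=2m$ and $\boldsymbol{\eta}_a=(\eta_{a_1},\ldots,\eta_{a_m})$, then $\omega(\tilde G_{\boldsymbol{\eta}_a}[X;q])=q^{M}s^{(2)}_{(2^l,1^{n-2l})}[X;q]$ with $M=\sum_{i=1}^{l}(m-i)$. (ii) If $n=2m+1$ and $\boldsymbol{\eta}_a=(\eta_{a_1},\ldots,\eta_{a_m},b)$ where $b$ is a single cell of content $0$, then $\omega(\tilde G_{\boldsymbol{\eta}_a}[X;q])=q^{M'}s^{(2)}_{(2^l,1^{n-2l})}[X;q]$ with $M'=\sum_{i=1}^{l}(m-i+1)$.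
   Context: Diagrams in English notation; the content of the cell in row $r$, column $c$ is $c-r$. A horizontal domino with content set $\{0,1\}$ is two cells in one row in adjacent columns with contents $0$ (left) and $1$ (right); a vertical domino with content set $\{0,1\}$ is two cells in one column in adjacent rows with contents $1$ (upper) and $0$ (lower). For a $d$-tuple $\boldsymbol{\lambda}=(\lambda^{(0)},\ldots,\lambda^{(d-1)})$ of skew diagrams, the shifted content of a cell $x$ of $\lambda^{(i)}$ is $\tilde c(x)=d\,c(x)+i$. For a semistandard filling $T$ (each $\lambda^{(i)}$ filled as a semistandard skew tableau: rows weakly increasing, columns strictly increasing), $\mathrm{Inv}(T)$ is the set of pairs of cells $(x,y)$ with $0<\tilde c(y)-\tilde c(x)<d$ and $T(x)>T(y)$, and $\tilde G_{\boldsymbol{\lambda}}[X;q]=\sum_Tq^{|\mathrm{Inv}(T)|}\prod_x x_{T(x)}$. $\omega$ is the involution with $\omega(h_r)=e_r$. $2$-Schur functions: over $\mathbb{Q}(q)$, $\mathbb{S}_a=\sum_{r\ge0}(-1)^rh_{a+r}e_r^\perp$, $\mathbb{B}_a=\sum_{j\ge0}q^j\mathbb{S}_{a+j}h_j^\perp$, $\mathbb{B}_\nu=\sum_{\sigma\in S_\ell}\mathrm{sgn}(\sigma)\mathbb{B}_{\nu_1+\sigma(1)-1}\cdots\mathbb{B}_{\nu_\ell+\sigma(\ell)-\ell}$ ($f^\perp$ adjoint to multiplication by $f$ under the Hall inner product; $h_r=e_r=0$ for $r<0$). For $k$-bounded $\lambda$ the $k$-split $(\lambda^{(1)},\ldots,\lambda^{(r)})$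 takes successively the longest initial segment of remaining parts of hook length $\nu_1+\ell(\nu)-1\le k$; $C^{(k)}_\lambda=\mathbb{B}_{\lambda^{(1)}}\cdots\mathbb{B}_{\lambda^{(r)}}(1)$; $T^{(k)}_i$ is linear on the span of the independent $C^{(k)}_\lambda$, fixing those with $\lambda_1=i$ and killing the others; $s^{(k)}_\emptyset=1$, $s^{(k)}_{(a)}=s_a$ ($a\le k$), $s^{(k)}_{(m,\lambda)}=T^{(k)}_m\mathbb{B}_ms^{(k)}_\lambda$ for nonempty $k$-bounded $\lambda$, $\lambda_1\le m\le k$.
   Formalization: B_ν is taken as ∏_{i<j}(1−qR_ij) applied to B_{ν_1}…B_{ν_ℓ} (R_ij raises index i, lowers index j), not the determinant sum over σ, which lacks q; with that sum the claim fails for m=1, a=(0): s^{(2)}_{(1,1)} would be e_2+(q−1)h_2, not e_2. *)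

(* Defs.v *)
From Stdlib Require Import ClassicalEpsilon.
From HB Require Import structures.
From mathcomp Require Import all_boot all_order all_fingroup all_algebra.
From mathcomp Require Import finmap monalg mpoly zify.

Set Implicit Arguments.
Unset Strict Implicit.
Unset Printing Implicit Defensive.

Import GRing.Theory.
Local Open Scope ring_scope.

(* Symmetric functions over a field F of characteristic 0, as the polynomial
   ring in the power sums: the variable of index i is p_(i+1).  A monomial
   m : {cmonom nat} stands for the partition with m i parts equal to i+1. *)
Notation Sym F := {malg F[{cmonom nat}]}.

Definition psum (F : fieldType) (i : nat) : Sym F := << ucm i >>.

Definition mon_eval (F : fieldType) (S : comAlgType F) (v : nat -> S)
    (m : {cmonom nat}) : S :=
  \prod_(i <- finsupp m) v i ^+ m i.

(* The morphism of algebras sending p_(i+1) to v i. *)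
Definition subst (F : fieldType) (S : comAlgType F) (v : nat -> S) : Sym F -> S :=
  monalg.mmap (in_alg S) (mon_eval v).

Section Subst.
Context (F : fieldType) (S : comAlgType F) (v : nat -> S).

Lemma mon_evalEw (d : {fset nat}) (m : {cmonom nat}) : (finsupp m `<=` d)%fset ->
  mon_eval v m = \prod_(i <- d) v i ^+ m i.
Proof.
move=> le; rewrite /mon_eval (big_fset_incl _ le) //.
by move=> i _; rewrite -cmE_neq0 negbK => /eqP ->; rewrite expr0.
Qed.

Lemma mon_eval_mmorphism : mmorphism (mon_eval v).
Proof.
split=> [m1 m2|]; last by rewrite /mon_eval mdom1 big_seq_fset0.
rewrite {1}/mon_eval mdomD (mon_evalEw (fsubsetUl _ (finsupp m2))).
rewrite (mon_evalEw (fsubsetUr (finsupp m1) _)) -big_split /=.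
by apply: eq_bigr => i _; rewrite cmM exprD.
Qed.

HB.instance Definition _ :=
  monalg.isMultiplicative.Build {cmonom nat} S (mon_eval v) mon_eval_mmorphism.

HB.instance Definition _ := GRing.RMorphism.copy (subst v)
  (monalg.mmap (in_alg S) (mon_eval v)).

Lemma subst_is_scalable : scalable (subst v).
Proof. by move=> c f; rewrite /subst monalg.mmapZ /= mulr_algl. Qed.

HB.instance Definition _ :=
  GRing.isScalable.Build F (Sym F) S *:%R (subst v) subst_is_scalable.

Lemma substU (c : F) m : subst v << c *g m >> = c *: mon_eval v m.
Proof. by rewrite /subst monalg.mmapU /= mulr_algl. Qed.

Lemma subst_psum i : subst v (psum F i) = v i.
Proof.
by rewrite /psum substU scale1r /mon_eval mdomU big_seq_fset1 cmUU expr1.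
Qed.
End Subst.

Section SymFun.
Context (F : fieldType).
Local Notation Lam := (Sym F).

(* Newton's identities: r h_r = \sum_i p_i h_(r-i) for s = 1, and
   r e_r = \sum_i (-1)^(i-1) p_i e_(r-i) for s = -1.
   newton s n lists the values for r = n, n-1, ..., 0. *)
Fixpoint newton (s : F) (n : nat) : seq Lam :=
  if n is n'.+1 then
    let l := newton s n' in
    n%:R^-1 *: (\sum_(i < n) s ^+ i *: (psum F i * nth 0 l i)) :: l
  else [:: 1].

Definition h_ (r : nat) : Lam := head 0 (newton 1 r).
Definition e_ (r : nat) : Lam := head 0 (newton (-1) r).

Definition hZ (a : int) : Lam := if a is Posz r then h_ r else 0.

Lemma nth_newton s n i : (i <= n)%N ->
  nth 0 (newton s n) i = head 0 (newton s (n - i)).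
Proof.
elim: n i => [|n IH] [|i] //= le_in.
by rewrite IH // subSS.
Qed.

Lemma newton_rec s n : head 0 (newton s n.+1) =
  n.+1%:R^-1 *: \sum_(i < n.+1) s ^+ i *: (psum F i * head 0 (newton s (n - i))).
Proof.
have -> : newton s n.+1 = n.+1%:R^-1 *:
  (\sum_(i < n.+1) s ^+ i *: (psum F i * nth 0 (newton s n) i)) :: newton s n.
  by [].
rewrite /head; apply: (congr1 (fun x => _ *: x)); apply: eq_bigr => i _.
by rewrite nth_newton // -ltnS.
Qed.

(* The value of a symmetric function at (x_0, ..., x_(N-1), 0, 0, ...). *)
Definition evalx (N : nat) : Lam -> mpoly.mpoly N F :=
  subst (fun i => \sum_(j < N) 'X_j ^+ i.+1).

Definition omega : Lam -> Lam := subst (fun i => (-1) ^+ i *: psum F i).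

HB.instance Definition _ N := GRing.LRMorphism.copy (@evalx N)
  (subst (fun i => \sum_(j < N) 'X_j ^+ i.+1)).
HB.instance Definition _ := GRing.LRMorphism.copy omega
  (subst (fun i => (-1) ^+ i *: psum F i)).

Lemma evalx_psum N i : evalx N (psum F i) = \sum_(j < N) 'X_j ^+ i.+1.
Proof. exact: subst_psum. Qed.

Lemma omega_psum i : omega (psum F i) = (-1) ^+ i *: psum F i.
Proof. exact: subst_psum. Qed.

Lemma omega_newton s n :
  omega (head 0 (newton s n)) = head 0 (newton (- s) n).
Proof.
elim/ltn_ind: n => [[|n]] IH; first exact: (rmorph1 omega).
have omegaZ c f : omega (c *: f) = c *: omega f by exact: linearZ_LR.
have omegaM f g : omega (f * g) = omega f * omega g by exact: (rmorphM omega).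
have omegaS k (f : 'I_k -> Lam) : omega (\sum_i f i) = \sum_i omega (f i).
  exact: (linear_sum omega).
rewrite !newton_rec omegaZ omegaS.
apply: (congr1 (fun x => _ *: x)); apply: eq_bigr => i _.
have le_in : (n - i < n.+1)%N by rewrite ltnS leq_subr.
rewrite omegaZ omegaM omega_psum (IH _ le_in).
by rewrite -scalerAl scalerA -exprMn mulrN1.
Qed.

Lemma omega_h r : omega (h_ r) = e_ r.
Proof. exact: omega_newton. Qed.

Lemma omega_e r : omega (e_ r) = h_ r.
Proof. by rewrite /e_ omega_newton opprK. Qed.

Definition zee (m : {cmonom nat}) : F :=
  (\prod_(i <- finsupp m) (i.+1 ^ m i * (m i)`!))%:R.

(* <p_lambda, p_mu> = z_lambda if lambda = mu, and 0 otherwise. *)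
Definition hall (f g : Lam) : F :=
  \sum_(m <- monalg.msupp f)
    monalg.mcoeff m f * monalg.mcoeff m g * zee m.

(* p_m^perp p_m' = (z_m' / z_(m'/m)) p_(m'/m), which is 0 if m does not divide
   m'; perp_unique identifies perp f with the adjoint of multiplication by f. *)
Definition perp_mon (m m' : {cmonom nat}) : Lam :=
  let d := divcm m' m in
  if m' == mulcm m d then << zee m' / zee d *g d >> else 0.

Definition perp (f g : Lam) : Lam :=
  \sum_(m <- monalg.msupp f) \sum_(m' <- monalg.msupp g)
    (monalg.mcoeff m f * monalg.mcoeff m' g) *: perp_mon m m'.

(* The degree in x: the variable p_(i+1) has weight i+1. *)
Definition weight (m : {cmonom nat}) : nat := \sum_(i <- finsupp m) m i * i.+1.

Definition xdeg (f : Lam) : nat := \max_(m <- monalg.msupp f) weight m.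

Lemma weightEw (d : {fset nat}) (m : {cmonom nat}) : (finsupp m `<=` d)%fset ->
  weight m = (\sum_(i <- d) m i * i.+1)%N.
Proof.
move=> le; rewrite /weight (big_fset_incl _ le) //.
by move=> i _; rewrite -cmE_neq0 negbK => /eqP ->.
Qed.

Lemma weightM m1 m2 : weight (mulcm m1 m2) = (weight m1 + weight m2)%N.
Proof.
rewrite {1}/weight (mdomD m1 m2) (weightEw (fsubsetUl _ (finsupp m2))).
rewrite (weightEw (fsubsetUr (finsupp m1) _)) -big_split /=.
by apply: eq_bigr => i _; rewrite mulcmE mulnDl.
Qed.

Lemma weightU i : weight (ucm i) = i.+1.
Proof. by rewrite /weight mdomU big_seq_fset1 cmUU mul1n. Qed.

Lemma newton_weight s n m :
  monalg.mcoeff m (head 0 (newton s n)) != 0 -> weight m = n.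
Proof.
elim/ltn_ind: n m => [[|n]] IH m.
  rewrite [head _ _]/(1 : Lam) monalg.mcoeff1; case: (m =P mone) => [-> _|_]; last by rewrite eqxx.
  by rewrite /weight mdom1 big_seq_fset0.
rewrite newton_rec monalg.mcoeffZ mulf_eq0 negb_or => /andP[_].
rewrite (raddf_sum (monalg.mcoeff m)) => nz.
have /existsP[i] : [exists i : 'I_n.+1, monalg.mcoeff m
    (s ^+ i *: (psum F i * head 0 (newton s (n - i)))) != 0].
  apply: contraNT nz => /existsPn z.
  by rewrite big1 // => i _; apply/eqP; rewrite -[_ == _]negbK z.
rewrite monalg.mcoeffZ mulf_eq0 negb_or => /andP[_].
rewrite monalg.mcoeff_neq0 => /(fsubsetP (msuppM_incl _ _)).
rewrite monalg.msuppU1 => /imfset2P[k1 /= /fset1P -> [k2 k2in ->]].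
have le_in : (n - i < n.+1)%N by rewrite ltnS leq_subr.
have le2 : (i <= n)%N by rewrite -ltnS.
have w2 : weight k2 = (n - i)%N by apply: (IH _ le_in); rewrite monalg.mcoeff_neq0.
by rewrite weightM weightU w2 addSn subnKC.
Qed.

Lemma perp_eq0 (f g : Lam) :
  (forall m, monalg.mcoeff m f != 0 -> (xdeg g < weight m)%N) -> perp f g = 0.
Proof.
move=> fg; rewrite /perp big_seq big1 // => m; rewrite -monalg.mcoeff_neq0 => nzm.
rewrite big_seq big1 // => m' m'g; rewrite /perp_mon; case: eqP => [m'E|_].
  have := fg m nzm; rewrite ltnNge => /negP[].
  apply: leq_trans (leq_addr (weight (divcm m' m)) _) _; rewrite -weightM -m'E.
  by rewrite /xdeg (big_rem _ m'g) leq_maxl.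
exact: scaler0.
Qed.

Lemma perp_h_eq0 r g : (xdeg g < r)%N -> perp (h_ r) g = 0.
Proof. by move=> gr; apply: perp_eq0 => m /newton_weight ->. Qed.

Lemma perp_e_eq0 r g : (xdeg g < r)%N -> perp (e_ r) g = 0.
Proof. by move=> gr; apply: perp_eq0 => m /newton_weight ->. Qed.

Lemma hallEw (d : {fset {cmonom nat}}) f g : (monalg.msupp f `<=` d)%fset ->
  hall f g = \sum_(m <- d) monalg.mcoeff m f * monalg.mcoeff m g * zee m.
Proof.
move=> le; rewrite /hall (big_fset_incl _ le) // => m _.
by rewrite -monalg.mcoeff_neq0 negbK => /eqP ->; rewrite !mul0r.
Qed.

Lemma hallDl f1 f2 g : hall (f1 + f2) g = hall f1 g + hall f2 g.
Proof.
rewrite (hallEw _ (monalg.msuppD_le f1 f2)) (hallEw _ (fsubsetUl _ (monalg.msupp f2))).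
rewrite (hallEw _ (fsubsetUr (monalg.msupp f1) _)) -big_split /=.
by apply: eq_bigr => m _; rewrite monalg.mcoeffD !mulrDl.
Qed.

Lemma hall0l g : hall 0 g = 0.
Proof. by rewrite /hall monalg.msupp0 big_seq_fset0. Qed.

Lemma hallZl c f g : hall (c *: f) g = c * hall f g.
Proof.
rewrite (hallEw _ (monalg.msuppZ_le c f)) [hall f g]/hall big_distrr /=.
by apply: eq_bigr => m _; rewrite monalg.mcoeffZ !mulrA.
Qed.

Lemma hall_suml (I : Type) (r : seq I) (f : I -> Lam) g :
  hall (\sum_(i <- r) f i) g = \sum_(i <- r) hall (f i) g.
Proof. by apply: (big_morph (hall^~ g)) => [x y|]; [exact: hallDl|exact: hall0l]. Qed.

Lemma hallU c m g : hall << c *g m >> g = c * monalg.mcoeff m g * zee m.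
Proof.
rewrite (hallEw _ (monalg.msuppU_le)) big_seq_fset1.
by rewrite monalg.mcoeffUU.
Qed.

Lemma hallC f g : hall f g = hall g f.
Proof.
rewrite (hallEw _ (fsubsetUl _ (monalg.msupp g))).
rewrite (hallEw _ (fsubsetUr (monalg.msupp f) _)).
by apply: eq_bigr => m _; rewrite [_ * monalg.mcoeff m g]mulrC.
Qed.

Hypothesis F0 : [pchar F] =i pred0.

Lemma zee_neq0 m : zee m != 0.
Proof.
rewrite /zee ((pcharf0P F).1 F0) -lt0n prodn_gt0 // => i.
by rewrite muln_gt0 expn_gt0 fact_gt0.
Qed.

Lemma hall_nondegenerate f : (forall g, hall f g = 0) -> f = 0.
Proof.
move=> f0; apply/monalg.malgP => m; rewrite monalg.mcoeff0.
have /eqP := f0 << m >>; rewrite hallC hallU mul1r mulf_eq0 (negbTE (zee_neq0 m)).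
by rewrite orbF => /eqP.
Qed.

Lemma hall_perp f u v : hall (perp f u) v = hall u (f * v).
Proof.
rewrite /perp hall_suml [RHS]/hall; under eq_bigr do rewrite hall_suml.
rewrite exchange_big /=; apply: eq_bigr => m' _.
rewrite monalg.mcoeffMl mulr_sumr mulr_suml; apply: eq_bigr => m _.
rewrite hallZl [monalg.mcoeff m f * _]mulrC -!mulrA; congr (_ * _).
have cancel k : (mmul m k == m') = (m' == mulcm m (divcm m' m)) && (k == divcm m' m).
  apply/eqP/andP => [<-|[/eqP m'E /eqP ->]]; last by rewrite {2}m'E.
  have -> : divcm (mmul m k) m = k.
    by apply/eqP/cmP => i; rewrite divcmE mulcmE addKn.
  by split.
under [in RHS]eq_bigr do rewrite cancel.
rewrite /perp_mon; case: (m' == mulcm m _) => /=; last first.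
  by rewrite hall0l mulr0 big1 ?mul0r.
set d := divcm m' m; rewrite hallU mulrAC -!mulrA [_^-1 * _]mulrA mulVf ?zee_neq0 // mul1r.
case: (boolP (d \in monalg.msupp v)) => [dv|].
  rewrite (big_rem _ dv) /= eqxx mulr1n big_seq big1 ?addr0; last first.
    move=> k; rewrite mem_rem_uniq ?fset_uniq // => /andP[/negbTE /= -> _].
    exact: mulr0n.
  by rewrite -mulrA [_ * zee _]mulrC.
move=> dv; rewrite big_seq big1 ?mul0r; last first.
  by move=> k kv; case: eqP => [kd|_]; rewrite ?mulr0n // -kd kv in dv.
by move: dv; rewrite -monalg.mcoeff_neq0 negbK => /eqP ->; rewrite !mulr0.
Qed.

Lemma perp_unique f T : (forall u v, hall (T u) v = hall u (f * v)) -> T =1 perp f.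
Proof.
move=> adj u; apply/eqP; rewrite -subr_eq0; apply/eqP/hall_nondegenerate => v.
by rewrite hallDl -scaleN1r hallZl adj hall_perp mulN1r subrr.
Qed.


Lemma evalx_newton N s (E : nat -> mpoly.mpoly N F) : E 0%N = 1 ->
  (forall n, E n.+1 *+ n.+1 =
    \sum_(i < n.+1) s ^+ i *: ((\sum_(j < N) 'X_j ^+ i.+1) * E (n - i)%N)) ->
  forall n, evalx N (head 0 (newton s n)) = E n.
Proof.
move=> E0 ES; elim/ltn_ind => [[|n]] IH; first by rewrite E0; exact: (rmorph1 (evalx N)).
have evalxZ c f : evalx N (c *: f) = c *: evalx N f by exact: linearZ_LR.
have evalxM f g : evalx N (f * g) = evalx N f * evalx N g by exact: (rmorphM (evalx N)).
have evalxS k (f : 'I_k -> Lam) : evalx N (\sum_i f i) = \sum_i evalx N (f i).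
  exact: (linear_sum (evalx N)).
have nz : n.+1%:R != 0 :> F by rewrite ((pcharf0P F).1 F0).
rewrite newton_rec evalxZ evalxS.
apply: (canLR (scalerK nz)); rewrite scaler_nat ES; apply: eq_bigr => i _.
have le_in : (n - i < n.+1)%N by rewrite ltnS leq_subr.
by rewrite evalxZ evalxM evalx_psum (IH _ le_in).
Qed.

Lemma mcoeff_chom N r (m : 'X_{1..N}) :
  mcoeff m (\sum_(k : 'X_{1..N < r.+1} | mdeg k == r) 'X_[k] : mpoly.mpoly N F) =
  (mdeg m == r)%:R.
Proof.
rewrite raddf_sum /=; case: (mdeg m =P r) => mr.
  have mlt : (mdeg m < r.+1)%N by rewrite mr.
  rewrite (bigD1 (BMultinom mlt)) /= ?mr // mcoeffX eqxx big1 ?addr0 // => k.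
  move=> /andP[_]; rewrite -val_eqE /= mcoeffX => /negbTE -> //.
rewrite big1 // => k /eqP kr; rewrite mcoeffX; case: eqP => // km.
by case: mr; rewrite -km.
Qed.

Lemma mcoeffXnM N (p : mpoly.mpoly N F) j i (m : 'X_{1..N}) :
  mcoeff m ('X_j ^+ i * p) =
  if (i <= m j)%N then mcoeff (m - U_(j) *+ i)%MM p else 0.
Proof.
have -> : 'X_j ^+ i = 'X_[(U_(j) *+ i)] :> mpoly.mpoly N F by rewrite mpolyXn.
have lej : (U_(j) *+ i <= m)%MM = (i <= m j)%N.
  apply/mnm_lepP/idP => [/(_ j)|le k]; first by rewrite mulmnE mnm1E eqxx mul1n.
  by rewrite mulmnE mnm1E; case: eqP => [<-|_]; rewrite ?mul1n ?mul0n.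
case: ifP => [|/negbT]; rewrite -lej => le.
  by rewrite -{1}(submK le) addmC mulrC mcoeffMX.
rewrite mulrC memN_msupp_eq0 // (perm_mem (msuppMX _ _)).
by apply: contraNN le => /mapP[k _ ->]; exact: lem_addr.
Qed.

Lemma evalx_h N r : evalx N (h_ r) =
  \sum_(m : 'X_{1..N < r.+1} | mdeg m == r) 'X_[m].
Proof.
apply: (evalx_newton (E := fun r => \sum_(m : 'X_{1..N < r.+1} | mdeg m == r) 'X_[m])) => [|n]; apply/mpolyP => m.
  by rewrite mcoeff_chom mcoeff1 mdeg_eq0.
rewrite mcoeffMn mcoeff_chom raddf_sum /=.
under eq_bigr => i _.
  rewrite expr1n scale1r mulr_suml raddf_sum /=.
  under eq_bigr => j _.
    rewrite mcoeffXnM mcoeff_chom.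
    have -> : (if (i < m j)%N then (mdeg (m - U_(j) *+ i.+1)%MM == n - i)%N%:R else 0 : F)
      = (mdeg m == n.+1)%:R *+ (i < m j)%N.
      case: ifP => // ij; rewrite mulr1n; congr (nat_of_bool _)%:R.
      have le : (U_(j) *+ i.+1 <= m)%MM.
        apply/mnm_lepP => k; rewrite mulmnE mnm1E.
        by case: eqP => [<-|_]; rewrite ?mul1n ?mul0n.
      rewrite -{2}(submK le) mdegD mdegMn mdeg1 mul1n.
      by rewrite -(eqn_add2r i.+1) !addnS subnK // -ltnS.
    over.
  over.
case: (mdeg m =P n.+1) => [mn|_]; last first.
  by rewrite mul0rn big1 // => i _; rewrite big1 // => j _; rewrite mul0rn.
have count t k : (\sum_(i < k) (i < t) = minn k t)%N.
  by elim: k => [|k IH]; rewrite ?big_ord0 ?min0n // big_ord_recr /= IH; lia.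
have -> : true%:R *+ n.+1 = (mdeg m)%:R :> F by rewrite mn.
rewrite exchange_big mdegE natr_sum; apply: eq_bigr => j _.
have mj : (m j <= n.+1)%N by rewrite -mn mdegE (bigD1 j) //= leq_addr.
by rewrite -{1}(minn_idPr mj) -count natr_sum.
Qed.

Section Mesym.
Context (N : nat).
Let D k i : mpoly.mpoly N F :=
  \sum_(p : {set 'I_N} * 'I_N | (#|p.1| == k) && (p.2 \notin p.1))
    'X_(p.2) ^+ i * \prod_(l in p.1) 'X_l.

Let D_shift k i :
  \sum_(p : {set 'I_N} * 'I_N | (#|p.1| == k.+1) && (p.2 \in p.1))
    'X_(p.2) ^+ i * \prod_(l in p.1) 'X_l = D k i.+1.
Proof.
rewrite /D (reindex_onto (fun p => (p.2 |: p.1, p.2)) (fun p => (p.1 :\ p.2, p.2)));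
  last by case=> S j /= /andP[_ jS]; rewrite setD1K.
apply: eq_big => [[S j]|[S j]] /=.
  rewrite setU11 andbT xpair_eqE eqxx andbT; case jS: (j \in S) => /=.
    rewrite andbF; apply/negbTE/negP => /andP[_ /eqP SE].
    by move: jS; rewrite -SE setD11.
  by rewrite setU1K ?jS // eqxx !andbT cardsU1 jS.
rewrite setU11 andbT xpair_eqE => /andP[_ /andP[/eqP SE _]].
have jS : j \notin S by rewrite -SE setD11.
by rewrite big_setU1 //= exprSr -mulrA.
Qed.

Lemma evalx_e r : evalx N (e_ r) = mesym N F r.
Proof.
apply: (evalx_newton (E := mesym N F)) => [|n]; first exact: mesym0E.
pose G i : mpoly.mpoly N F := if (i <= n)%N then D (n - i)%N i.+1 else 0.
have -> : mesym N F n.+1 *+ n.+1 = G 0%N.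
  rewrite /G subn0 -D_shift /mesym -sumrMnl.
  transitivity (\sum_(S : {set 'I_N} | #|S| == n.+1) \sum_(j in S)
      'X_j ^+ 0 * \prod_(l in S) 'X_l : mpoly.mpoly N F).
    apply: eq_bigr => S /eqP Sn; rewrite -Sn -sumr_const.
    by apply: eq_bigr => j _; rewrite expr0 mul1r.
  by rewrite pair_big_dep.
have PE i : (i <= n)%N ->
    (\sum_(j < N) 'X_j ^+ i.+1) * mesym N F (n - i)%N = G i + G i.+1.
  move=> le_in; rewrite /mesym mulr_sumr.
  under eq_bigr => S _ do rewrite mulr_suml (bigID (fun j => j \in S)) /=.
  rewrite big_split /= !pair_big_dep /= addrC /G le_in; congr (_ + _).
  case: ltnP => [lt_in|le_ni]; last first.
    rewrite big1 // => -[S j] /= /andP[]; have /eqP -> : (n - i == 0)%N by rewrite subn_eq0.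
    by rewrite cards_eq0 => /eqP ->; rewrite inE.
  by rewrite -D_shift subnSK.
under eq_bigr => i _ do rewrite PE -1?ltnS // scalerDr.
have tele k : \sum_(i < k) ((-1) ^+ i *: G i + (-1) ^+ i *: G i.+1) =
   G 0%N - (-1) ^+ k *: G k.
  elim: k => [|k IH]; first by rewrite big_ord0 expr0 scale1r subrr.
  by rewrite big_ord_recr /= IH addrA subrK exprS mulN1r scaleNr opprK.
by rewrite tele [G n.+1]/G ltnn scaler0 subr0.
Qed.
End Mesym.

End SymFun.

Section KSchur.
Context (F : fieldType) (q : F).
Local Notation Lam := (Sym F).

(* The terms of index r > xdeg f vanish, by perp_e_eq0 and perp_h_eq0. *)
Definition Sop (a : int) (f : Lam) : Lam :=
  \sum_(r < (xdeg f).+1) (-1) ^+ r *: (hZ F (a + r%:Z) * perp (e_ F r) f).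

Definition Bop (a : int) (f : Lam) : Lam :=
  \sum_(j < (xdeg f).+1) q ^+ j *: Sop (a + j%:Z) (perp (h_ F j) f).

(* nu + \sum_((i, j) in A) (eps_i - eps_j) *)
Definition raise (nu : seq nat) (A : {set 'I_(size nu) * 'I_(size nu)}) : seq int :=
  [seq (nth 0%N nu i)%:Z + #|[set p in A | p.1 == i]|%:Z
         - #|[set p in A | p.2 == i]|%:Z | i : 'I_(size nu)].

(* B_nu = \prod_(i < j) (1 - q R_ij) B_(nu_1) ... B_(nu_l), where the raising
   operator R_ij adds 1 to the i-th index and subtracts 1 from the j-th.
   At q = 1 this is the determinant \sum_sigma sgn(sigma) B_(nu_1+sigma(1)-1)
   ... B_(nu_l+sigma(l)-l).  The factor q in front of R_ij is what makes
   B_nu(1) the Schur function s_nu; without it B_(1,1)(1) would be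
   s_(1,1) + (q - 1) s_2. *)
Definition Bpart (nu : seq nat) (f : Lam) : Lam :=
  \sum_(A : {set 'I_(size nu) * 'I_(size nu)} | [forall p in A, p.1 < p.2]%N)
    (- q) ^+ #|A| *: foldr Bop f (raise A).

Definition hook_length (nu : seq nat) : nat := (head 0 nu + size nu).-1.

Definition split_size (k : nat) (la : seq nat) : nat :=
  \max_(j < (size la).+1 | (hook_length (take j la) <= k)%N) j.

Fixpoint ksplit_rec (n k : nat) (la : seq nat) : seq (seq nat) :=
  if n is n'.+1 then
    if la is [::] then [::] else
      let j := split_size k la in take j la :: ksplit_rec n' k (drop j la)
  else [::].

(* Each segment of a k-bounded partition is nonempty, so size la steps
   exhaust la. *)
Definition ksplit (k : nat) (la : seq nat) : seq (seq nat) :=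
  ksplit_rec (size la) k la.

Definition Csplit (k : nat) (la : seq nat) : Lam := foldr Bpart 1 (ksplit k la).

Definition is_part (la : seq nat) : bool := sorted geq la && (0%N \notin la).

Definition kbounded (k : nat) (la : seq nat) : bool :=
  is_part la && all (fun a => (a <= k)%N) la.

(* c is the family of coordinates of f in the C^(k)_lambda, lambda k-bounded. *)
Definition is_kcoord (k : nat) (f : Lam) (c : {malg F[seq nat]}) : Prop :=
  (forall la, la \in monalg.msupp c -> kbounded k la) /\
  f = \sum_(la <- monalg.msupp c) monalg.mcoeff la c *: Csplit k la.

Definition kcoord (k : nat) (f : Lam) : {malg F[seq nat]} :=
  epsilon (inhabits 0) (is_kcoord k f).

(* Only meaningful on the span of the C^(k)_lambda. *)
Definition Tproj (k i : nat) (f : Lam) : Lam :=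
  \sum_(la <- monalg.msupp (kcoord k f) | head 0%N la == i)
    monalg.mcoeff la (kcoord k f) *: Csplit k la.

(* s_(a) = h_a for a one-row partition. *)
Fixpoint kschur (k : nat) (la : seq nat) : Lam :=
  match la with
  | [::] => 1
  | [:: a] => h_ F a
  | a :: mu => Tproj k a (Bop a%:Z (kschur k mu))
  end.

End KSchur.

Record skew_diagram := SkewDiagram {
  outer : seq nat;
  inner : seq nat;
  outer_part : is_part outer;
  inner_part : is_part inner;
  inner_outer : forall r, (nth 0 inner r <= nth 0 outer r)%N
}.

(* A cell is a pair (row, column), both numbered from 0. *)
Definition cells (D : skew_diagram) : seq (nat * nat) :=
  [seq (r, c) | r <- iota 0 (size (outer D)),
                c <- iota (nth 0 (inner D) r) (nth 0 (outer D) r - nth 0 (inner D) r)%N].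

Definition content (x : nat * nat) : int := x.2%:Z - x.1%:Z.

Definition horizontal_domino01 (D : skew_diagram) : Prop :=
  exists r c, [/\ cells D =i [:: (r, c); (r, c.+1)],
                  content (r, c) = 0 & content (r, c.+1) = 1].

Definition vertical_domino01 (D : skew_diagram) : Prop :=
  exists r c, [/\ cells D =i [:: (r, c); (r.+1, c)],
                  content (r, c) = 1 & content (r.+1, c) = 0].

Definition single_cell0 (D : skew_diagram) : Prop :=
  exists r c, cells D =i [:: (r, c)] /\ content (r, c) = 0.

Section LLT.
Context (F : fieldType) (q : F) (d : nat) (lam : d.-tuple skew_diagram).

Definition tcells : seq ('I_d * (nat * nat)) :=
  [seq (i, x) | i <- enum 'I_d, x <- cells (tnth lam i)].

Definition tcell : finType := seq_sub tcells.

Definition comp (x : tcell) : 'I_d := (val x).1.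
Definition row_of (x : tcell) : nat := (val x).2.1.
Definition col_of (x : tcell) : nat := (val x).2.2.

Definition shifted_content (x : tcell) : int :=
  d%:Z * content (val x).2 + (comp x : nat)%:Z.

Definition semistandard (N : nat) (T : {ffun tcell -> 'I_N}) : bool :=
  [forall x, forall y, (comp x == comp y) ==>
     [&& (row_of x == row_of y) && (col_of x < col_of y)%N ==> (T x <= T y)%N
       & (col_of x == col_of y) && (row_of x < row_of y)%N ==> (T x < T y)%N]].

Definition Inv (N : nat) (T : {ffun tcell -> 'I_N}) : {set tcell * tcell} :=
  [set p | (0 < shifted_content p.2 - shifted_content p.1 < d%:Z)%R
           && (T p.2 < T p.1)%N].

(* \tilde G_lambda in the variables x_0, ..., x_(N-1). *)
Definition LLT (N : nat) : mpoly.mpoly N F :=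
  \sum_(T : {ffun tcell -> 'I_N} | semistandard T)
    q ^+ #|Inv T| *: \prod_x 'X_(T x).

(* G is the symmetric function \tilde G_lambda in infinitely many variables:
   its restriction to any finite number of variables is the LLT polynomial. *)
Definition is_LLT (G : Sym F) : Prop := forall N, evalx N G = LLT N.

End LLT.

Notation Qq := {fraction {poly rat}}.
Definition qvar : Qq := tofrac 'X.

Lemma pchar_Qq : [pchar Qq] =i pred0.
Proof.
apply/pcharf0P => n; rewrite -(rmorph_nat (@tofrac _)) tofrac_eq0.
by rewrite -(rmorph_nat (@polyC _)) polyC_eq0 Num.Theory.pnatr_eq0.
Qed.

(* Main.v *)
(** Two cells can form an inversion exactly when their shifted contents differ by
    less than d, and the two cells of a domino are those at distance exactly d.
    Peeling off the dominoes one by one writes the LLT polynomial as an iteration of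
    two operators V (vertical) and H (horizontal) acting on functionals of the
    weights of the letters in the content-0 and content-1 cells.  V and H commute, so
    only the number l of vertical dominoes matters.  Adding a vertex adjacent to
    everything is an operator U with UH = HU and UV = qVU, the relations satisfied
    by B_1 with B_11 and B_2.

    For two disjoint cliques of a and b cells the generating functions are
    omega (B_1^a 1) and omega (B_1^b 1), and joining the cliques edge by edge obeys
    the same recursion as B_1^(a+1) 1 * B_1^(b+1) 1 =
    B_1 (B_1^(a+1) 1 * B_1^b 1) + (1 - q^(a+1)) B_2 (B_1^a 1 * B_1^b 1).
    This identifies V^l U^j with a power of q times omega (B_2^l B_1^j 1).
    An innermost pair satisfies qV + H = U^2, which removes the horizontal dominoes.

    On the algebra side B_a f = sum_k h_(a+k) theta_k f, with theta_k adjoint to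
    multiplication by the coefficient of t^k in exp (sum_i (q^i - 1) p_i t^i / i).
    The commutation relations that follow give C_(2^l 1^p) = B_2^l B_11^(p/2) B_1^(p mod 2) 1.
    In two variables the leading monomials of omega C_(2^l 1^p) are distinct, so the
    C are independent, the projections T_i act trivially and the 2-Schur functions
    are the C themselves. *)
From Stdlib Require Import ClassicalEpsilon FunctionalExtensionality.
Require Import Defs.
From HB Require Import structures.
From mathcomp Require Import all_boot all_order all_algebra.
From mathcomp Require Import finmap monalg mpoly zify ring.

Set Implicit Arguments.
Unset Strict Implicit.
Unset Printing Implicit Defensive.

Import GRing.Theory.
Local Open Scope ring_scope.

(** * Convolution over triples of indices, and two families of q-coefficients *)

Lemma triangle_sum (V : nmodType) (f : nat -> nat -> nat -> V) n :
  \sum_(a < n.+1) \sum_(i < a.+1) f i (a - i)%N (n - a)%N =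
  \sum_(i < n.+1) \sum_(b < (n - i).+1) f i b (n - i - b)%N.
Proof.
under eq_bigr => a _.
  rewrite (big_ord_widen n.+1 (fun i => f i (a - i)%N (n - a)%N)) //.
  over.
rewrite (exchange_big_dep xpredT) //=; apply: eq_bigr => i _.
have -> : (n - i).+1 = (n.+1 - i)%N by rewrite subSn // -ltnS.
rewrite -(big_mkord xpredT (fun b => f i b (n - i - b)%N)).
under eq_bigl => a do rewrite ltnS.
rewrite -(big_geq_mkord _ _ xpredT (fun a => f i (a - i)%N (n - a)%N)).
rewrite -[X in \sum_(X <= _ < _) _]add0n big_addn.
by apply: eq_bigr => b _; rewrite addnK subnDA subnAC.
Qed.

(** The coefficient of t^k in (1 - t) / (1 - q t), which is the factor in theta_k h_a = [h_coef q k]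
    h_(a-k). *)
Definition h_coef (R : pzRingType) (q : R) k : R :=
  if k is k'.+1 then q ^+ k - q ^+ k' else 1.

(* theta_k (B_1^n 1) = B1pow_coef q n k *: B_1^(n-k) 1. *)
Definition B1pow_coef (R : comNzRingType) (q : R) n k : R :=
  (-1) ^+ k * \prod_(i < k) (1 - q ^+ (n - i)).

Lemma B1pow_coef_SS (R : comNzRingType) (q : R) n k :
  B1pow_coef q n.+1 k.+1 = - (1 - q ^+ n.+1) * B1pow_coef q n k.
Proof.
rewrite /B1pow_coef big_ord_recl exprS /= subn0.
under eq_bigr => i _ do rewrite /bump /= subSS.
by ring.
Qed.

(** * Domino operators and cliques acting on functionals of letter weights *)

Section Words.
Context (S : idomainType) (q : S) (N : nat).
Hypothesis two_neq0 : 2%:R != 0 :> S.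
Local Notation I := 'I_N.
Local Notation ctx := (I -> S).
Local Notation fctl := (ctx -> ctx -> S).
Implicit Types (al be : ctx) (K : fctl) (c p r v : I).

(* A context assigns a weight to each letter; a functional K al be is a generating
   function in which letters in content-0 cells weigh al and those in content-1
   cells weigh be.  Fixing a letter v multiplies by q the weight of each letter with
   which v forms an inversion: the letters above v (up) in cells preceding v, those
   below v (dn) in cells following v. *)
Definition up v al : ctx := fun c => q ^+ (v < c) * al c.
Definition dn v al : ctx := fun c => q ^+ (c < v) * al c.

Lemma up_up v w al : up v (up w al) = up w (up v al).
Proof. by extensionality c; rewrite /up mulrCA. Qed.

Lemma dn_dn v w al : dn v (dn w al) = dn w (dn v al).
Proof. by extensionality c; rewrite /dn mulrCA. Qed.

Lemma up_dn v w al : up v (dn w al) = dn w (up v al).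
Proof. by extensionality c; rewrite /up /dn mulrCA. Qed.

(** The new cell follows all content-0 cells, precedes all content-1 cells and is within reach of
    each of them. The choice of [al v] or [be v] decides whether operators applied further outside
    treat its letter as one of content 0 or of content 1. *)
Definition left_op K : fctl := fun al be => \sum_v al v * K (up v al) (dn v be).
Definition right_op K : fctl := fun al be => \sum_v be v * K (up v al) (dn v be).
(** Here [p] is the content-0 letter and [r] the content-1 letter of a domino placed before those of
    [K]. The cell of [r] lies between the remaining content-0 and content-1 cells; the cell of [p]
    is too far from the remaining content-1 cells to form inversions with them. *)
Definition domino_op (t : I -> I -> bool) K : fctl := fun al be =>
  \sum_p \sum_r (t p r)%:R * (al p * be r) * K (up r (dn p al)) (dn r be).
Definition vert_op := domino_op (fun p r => r < p)%N.
Definition horiz_op := domino_op (fun p r => p <= r)%N.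

(* Twice each sum is symmetrized along g, hence the need for 2 to be regular. *)
Lemma sum_sym (T : finType) (g : T -> T) (f1 f2 X : T -> S) : injective g ->
  (forall t, X (g t) = X t) -> (forall t, f1 t + f1 (g t) = f2 t + f2 (g t)) ->
  \sum_t f1 t * X t = \sum_t f2 t * X t.
Proof.
move=> gI XE fE; apply: (mulfI two_neq0); rewrite !mulr_natl !mulr2n.
rewrite {2}[\sum_t f1 t * X t](reindex_inj gI) {2}[\sum_t f2 t * X t](reindex_inj gI).
by rewrite -!big_split /=; apply: eq_bigr => t _; rewrite XE -!mulrDl fE.
Qed.

Lemma sum_sym2 (f1 f2 X : I -> I -> S) :
  (forall a b, X b a = X a b) -> (forall a b, f1 a b + f1 b a = f2 a b + f2 b a) ->
  \sum_a \sum_b f1 a b * X a b = \sum_a \sum_b f2 a b * X a b.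
Proof.
move=> XE fE; rewrite !pair_bigA.
apply: (@sum_sym _ (fun t => (t.2, t.1)) (fun t => f1 t.1 t.2) (fun t => f2 t.1 t.2)
  (fun t => X t.1 t.2)) => [[a b] [c d] [-> ->]//|[a b]|[a b]] /=; [exact: XE|exact: fE].
Qed.

Ltac cmp_cases := repeat match goal with
  | |- context [nat_of_bool (?a < ?b)%N] => case: (ltnP a b) => ? /=
  | |- context [nat_of_bool (?a <= ?b)%N] => case: (leqP a b) => ? /=
  end; rewrite ?expr0 ?expr1 ?mulr1n ?mulr0n ?mulr1 ?mul1r ?mul0r ?mulr0; try lia; try ring.

Lemma upE v al c : up v al c = q ^+ (v < c) * al c. Proof. by []. Qed.
Lemma dnE v al c : dn v al c = q ^+ (c < v) * al c. Proof. by []. Qed.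

Lemma right_op_domino_op t K al be : right_op (domino_op t K) al be =
  \sum_(p < N) \sum_(r < N) \sum_(v < N) ((t p r)%:R * q ^+ (v < p) * q ^+ (r < v)) *
    (al p * be r * be v * K (up r (up v (dn p al))) (dn r (dn v be))).
Proof.
rewrite /right_op /domino_op; under eq_bigr => v _ do rewrite mulr_sumr.
rewrite exchange_big /=; apply: eq_bigr => p _.
under eq_bigr => v _ do rewrite mulr_sumr.
rewrite exchange_big /=; apply: eq_bigr => r _; apply: eq_bigr => v _.
by rewrite upE dnE -up_dn; ring.
Qed.

Lemma domino_op_right_op t K al be : domino_op t (right_op K) al be =
  \sum_(p < N) \sum_(r < N) \sum_(v < N) ((t p r)%:R * q ^+ (v < r)) *
    (al p * be r * be v * K (up r (up v (dn p al))) (dn r (dn v be))).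
Proof.
rewrite /right_op /domino_op; apply: eq_bigr => p _; apply: eq_bigr => r _.
rewrite mulr_sumr; apply: eq_bigr => v _.
by rewrite dnE up_up dn_dn; ring.
Qed.

(** Once expanded, the summand is symmetric in the two content-1 letters [r] and [v], so the
    coefficients need only agree after symmetrization, which is a check over the relative orders of
    the letters. The same holds for horizontal dominoes, without the factor q. *)
Lemma right_op_vert_op K al be : right_op (vert_op K) al be = q * vert_op (right_op K) al be.
Proof.
rewrite /vert_op right_op_domino_op domino_op_right_op mulr_sumr; apply: eq_bigr => p _;
  rewrite mulr_sumr.
under [RHS]eq_bigr => r _.
  rewrite mulr_sumr; under eq_bigr => v _ do rewrite mulrA.
  over.
apply: sum_sym2 => [r v|r v].
  by rewrite up_up dn_dn; ring.
cmp_cases.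
Qed.

Lemma right_op_horiz_op K al be : right_op (horiz_op K) al be = horiz_op (right_op K) al be.
Proof.
rewrite /horiz_op right_op_domino_op domino_op_right_op; apply: eq_bigr => p _.
apply: sum_sym2 => [r v|r v]; first by rewrite up_up dn_dn; ring.
cmp_cases.
Qed.

Lemma left_op_domino_op t K al be : left_op (domino_op t K) al be = domino_op t (left_op K) al be.
Proof.
rewrite /left_op /domino_op; under eq_bigr => v _ do rewrite mulr_sumr.
rewrite exchange_big /=; apply: eq_bigr => p _.
under eq_bigr => v _ do rewrite mulr_sumr.
rewrite exchange_big /=; apply: eq_bigr => r _.
rewrite mulr_sumr; apply: eq_bigr => v _.
by rewrite !upE !dnE -(up_dn v p) (up_up r v) (dn_dn r v); ring.
Qed.

Lemma left_op_right_op K al be : left_op (right_op K) al be = right_op (left_op K) al be.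
Proof.
rewrite /left_op /right_op; under eq_bigr => v _ do rewrite mulr_sumr.
rewrite exchange_big /=; apply: eq_bigr => w _.
rewrite mulr_sumr; apply: eq_bigr => v _.
by rewrite upE dnE (up_up w v) (dn_dn w v); ring.
Qed.

Lemma left_op_diag K al : left_op K al al = right_op K al al.
Proof. by []. Qed.

(** The power of q counting the inversions between an outer domino (p, r) and an inner one (p',
    r'). *)
Definition crossing (p r p' r' : I) : S := q ^+ (p' < p) * q ^+ (r < p') * q ^+ (r' < r).

Lemma domino_op_domino_op t u K al be : domino_op t (domino_op u K) al be =
  \sum_(x : (I * I) * (I * I)) ((t x.1.1 x.1.2)%:R * (u x.2.1 x.2.2)%:R
       * crossing x.1.1 x.1.2 x.2.1 x.2.2) *
    (al x.1.1 * be x.1.2 * al x.2.1 * be x.2.2 *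
     K (up x.1.2 (up x.2.2 (dn x.1.1 (dn x.2.1 al)))) (dn x.1.2 (dn x.2.2 be))).
Proof.
rewrite /domino_op pair_bigA /=.
under eq_bigr => x _ do rewrite pair_bigA mulr_sumr.
rewrite pair_bigA; apply: eq_bigr => -[[p r] [p' r']] _ /=.
rewrite !upE !dnE /crossing -(up_dn r p') (up_up r' r) (dn_dn p' p) (dn_dn r' r).
by ring.
Qed.

Lemma sum_sym4 (f1 f2 X : (I * I) * (I * I) -> S) :
  (forall p r p' r', X ((p', r), (p, r')) = X ((p, r), (p', r'))) ->
  (forall p r p' r', X ((p, r'), (p', r)) = X ((p, r), (p', r'))) ->
  (forall p r p' r',
     f1 ((p, r), (p', r')) + f1 ((p', r), (p, r')) +
       (f1 ((p, r'), (p', r)) + f1 ((p', r'), (p, r))) =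
     f2 ((p, r), (p', r')) + f2 ((p', r), (p, r')) +
       (f2 ((p, r'), (p', r)) + f2 ((p', r'), (p, r)))) ->
  \sum_x f1 x * X x = \sum_x f2 x * X x.
Proof.
move=> X1 X2 fE; apply: (mulfI two_neq0); rewrite !mulr_natl.
pose g1 (x : (I * I) * (I * I)) := ((x.2.1, x.1.2), (x.1.1, x.2.2)).
pose g2 (x : (I * I) * (I * I)) := ((x.1.1, x.2.2), (x.2.1, x.1.2)).
have g1I : injective g1 by move=> [[a b] [c d]] [[a' b'] [c' d']] /= [-> -> -> ->].
have g2I : injective g2 by move=> [[a b] [c d]] [[a' b'] [c' d']] /= [-> -> -> ->].
have Xg1 x : X (g1 x) = X x by case: x => [[p r] [p' r']]; exact: X1.
have Xg2 x : X (g2 x) = X x by case: x => [[p r] [p' r']]; exact: X2.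
(* Doubling symmetrizes along [g1], the swap of the content-0 letters; [sum_sym] then symmetrizes
   along [g2], the swap of the content-1 letters. *)
have dbl f : (\sum_x f x * X x) *+ 2 = \sum_x (f x + f (g1 x)) * X x.
  rewrite mulr2n {2}(reindex_inj g1I) -big_split /=; apply: eq_bigr => x _.
  by rewrite Xg1 mulrDl.
rewrite !dbl; apply: (sum_sym g2I) => // -[[p r] [p' r']]; exact: fE.
Qed.

(** The two expansions share a summand that is invariant under swapping the content-0 letters and,
    independently, the content-1 letters. Their coefficients agree after averaging over these four
    arrangements. *)
Lemma vert_op_horiz_op K al be : vert_op (horiz_op K) al be = horiz_op (vert_op K) al be.
Proof.
rewrite /vert_op /horiz_op !domino_op_domino_op;
  apply: sum_sym4 => [p r p' r'|p r p' r'|p r p' r'] /=.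
- by rewrite (dn_dn p' p); ring.
- by rewrite (up_up r' r) (dn_dn r' r); ring.
by rewrite /crossing; cmp_cases.
Qed.

(** The LLT polynomial, in weights [al], of [n] single cells of equal content: any two cells are
    within reach of each other. The recursion peels off the last cell. *)
Fixpoint clique_sum n al : S := if n is n'.+1 then \sum_v al v * clique_sum n' (up v al) else 1.

Arguments clique_sum : simpl never.

Lemma clique_sumS n al : clique_sum n.+1 al = \sum_v al v * clique_sum n (up v al).
Proof. by []. Qed.

Lemma clique_sum_first n al : clique_sum n.+1 al = \sum_v al v * clique_sum n (dn v al).
Proof.
elim: n al => [|n IH] al //; rewrite clique_sumS.
under eq_bigr => v _ do rewrite IH mulr_sumr.
rewrite exchange_big; apply: eq_bigr => p _ /=; rewrite clique_sumS mulr_sumr.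
by apply: eq_bigr => v _; rewrite upE dnE up_dn; ring.
Qed.

(** By induction on [a], peeling the last letter [p] on both sides. The coefficients [f1] from the
    induction hypothesis and [f2] from the claim agree after symmetrization in the last two
    letters. *)
Lemma clique_sum_up a r al : clique_sum a.+1 al - clique_sum a.+1 (up r al) =
  (1 - q ^+ a.+1) * \sum_(p < N) (r < p)%:R * (al p * clique_sum a (up p al)).
Proof.
elim: a al => [|a IH] al.
  by rewrite !clique_sumS -sumrB mulr_sumr; apply: eq_bigr => p _; rewrite upE /clique_sum;
    cmp_cases.
pose X (p p' : I) := al p * al p' * clique_sum a (up p (up p' al)).
have XE p p' : X p' p = X p p' by rewrite /X up_up; ring.
pose f1 (p p' : I) : S := (1 - q ^+ (r < p)) * q ^+ (p < p')
  + (1 - q ^+ a.+1) * (q ^+ (r < p) * (r < p')%:R * q ^+ (p < p')).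
pose f2 (p p' : I) : S := (1 - q ^+ a.+2) * ((r < p)%:R * q ^+ (p < p')).
have E2 : (1 - q ^+ a.+2) * \sum_(p < N) (r < p)%:R * (al p * clique_sum a.+1 (up p al)) =
    \sum_p \sum_p' f2 p p' * X p p'.
  rewrite mulr_sumr; apply: eq_bigr => p _; rewrite clique_sumS !mulr_sumr.
  by apply: eq_bigr => p' _; rewrite upE up_up /f2 /X; ring.
rewrite E2 -(@sum_sym2 f1) // => [|p p']; last first.
  by rewrite /f1 /f2; have -> : q ^+ a.+2 = q * q ^+ a.+1; [rewrite exprS|cmp_cases].
rewrite [clique_sum a.+2 al]clique_sumS [clique_sum a.+2 (up r al)]clique_sumS -sumrB;
  apply: eq_bigr => p _.
have -> : \sum_p' f1 p p' * X p p' = (1 - q ^+ (r < p)) * (al p * clique_sum a.+1 (up p al)) +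
    q ^+ (r < p) * al p *
      ((1 - q ^+ a.+1) * \sum_(p' < N) (r < p')%:R * (up p al p' * clique_sum a (up p' (up p al)))).
  rewrite clique_sumS !mulr_sumr -big_split; apply: eq_bigr => p' _ /=.
  by rewrite upE up_up /f1 /X; ring.
by rewrite -IH upE up_up; ring.
Qed.

(** The mirror image of [clique_sum_up]: the first letter is peeled instead of the last, and the
    order of the letters is reversed. *)
Lemma clique_sum_dn b v be : clique_sum b.+1 be - clique_sum b.+1 (dn v be) =
  (1 - q ^+ b.+1) * \sum_(r < N) (r < v)%:R * (be r * clique_sum b (dn r be)).
Proof.
elim: b be => [|b IH] be.
  by rewrite !clique_sumS -sumrB mulr_sumr; apply: eq_bigr => p _; rewrite dnE /clique_sum;
    cmp_cases.
pose X (r r' : I) := be r * be r' * clique_sum b (dn r (dn r' be)).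
have XE r r' : X r' r = X r r' by rewrite /X dn_dn; ring.
pose f1 (r r' : I) : S := (1 - q ^+ (r < v)) * q ^+ (r' < r)
  + (1 - q ^+ b.+1) * (q ^+ (r < v) * (r' < v)%:R * q ^+ (r' < r)).
pose f2 (r r' : I) : S := (1 - q ^+ b.+2) * ((r < v)%:R * q ^+ (r' < r)).
have E2 : (1 - q ^+ b.+2) * \sum_(r < N) (r < v)%:R * (be r * clique_sum b.+1 (dn r be)) =
    \sum_r \sum_r' f2 r r' * X r r'.
  rewrite mulr_sumr; apply: eq_bigr => r _; rewrite clique_sum_first !mulr_sumr.
  by apply: eq_bigr => r' _; rewrite dnE dn_dn /f2 /X; ring.
rewrite E2 -(@sum_sym2 f1) // => [|r r']; last first.
  by rewrite /f1 /f2; have -> : q ^+ b.+2 = q * q ^+ b.+1; [rewrite exprS|cmp_cases].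
rewrite [clique_sum b.+2 be]clique_sum_first [clique_sum b.+2 (dn v be)]clique_sum_first -sumrB;
  apply: eq_bigr => r _.
have -> : \sum_r' f1 r r' * X r r' = (1 - q ^+ (r < v)) * (be r * clique_sum b.+1 (dn r be)) +
    q ^+ (r < v) * be r *
      ((1 - q ^+ b.+1) * \sum_(r' < N) (r' < v)%:R * (dn r be r' * clique_sum b (dn r' (dn r be)))).
  rewrite clique_sum_first !mulr_sumr -big_split; apply: eq_bigr => r' _ /=.
  by rewrite dnE dn_dn /f1 /X; ring.
by rewrite -IH dnE dn_dn; ring.
Qed.

(** On the left [p] stands first in its clique and a further letter [r] after it; on the right [p]
    stands last. This is the form in which a vertical domino laid over a clique appears. The
    induction peels a letter [p'] and symmetrizes in [p] and [p']. *)
Lemma clique_sum_above a r al :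
  \sum_(p < N) (r < p)%:R * (al p * clique_sum a (up r (dn p al))) =
  q ^+ a * \sum_(p < N) (r < p)%:R * (al p * clique_sum a (up p al)).
Proof.
elim: a al => [|a IH] al; first by rewrite mul1r.
pose X (p' p : I) := q ^+ a * (al p * al p' * clique_sum a (up p (up p' al))).
transitivity (\sum_(p' < N) \sum_(p < N)
    (q ^+ (r < p') * (r < p)%:R * q ^+ (p' < p)) * X p' p); last first.
  rewrite (@sum_sym2 _ (fun p' p : I => q * ((r < p)%:R * q ^+ (p < p')))).
  - rewrite exchange_big mulr_sumr; apply: eq_bigr => p _ /=.
    rewrite clique_sumS !mulr_sumr; apply: eq_bigr => p' _.
    by rewrite upE (up_up p' p) /X exprS; ring.
  - by move=> p' p; rewrite /X up_up; ring.
  - by move=> p' p; cmp_cases.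
under eq_bigr => p _ do rewrite clique_sumS !mulr_sumr.
rewrite exchange_big; apply: eq_bigr => p' _ /=.
transitivity (q ^+ (r < p') * al p' *
  \sum_(p < N) (r < p)%:R * (up p' al p * clique_sum a (up r (dn p (up p' al))))).
  rewrite mulr_sumr; apply: eq_bigr => p _.
  by rewrite !upE dnE -up_dn (up_up p' r); ring.
rewrite IH !mulr_sumr; apply: eq_bigr => p _.
by rewrite upE /X; ring.
Qed.

(* Two cliques without edges between them; linked_cliques adds the one pair (p, r)
   with p above r, with p and r joined to every other vertex of their own clique. *)
Definition cliques a b : fctl := fun al be => clique_sum a al * clique_sum b be.

Definition linked_cliques a b : fctl := fun al be =>
  \sum_(r < N) be r * clique_sum b (dn r be) * \sum_(p < N) (r < p)%:R * (al p * clique_sum a (up p al)).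

(** With the first letter [r] of the second clique peeled off, the two terms differ only in whether
    [r] is joined to the first clique, and [clique_sum_up] measures that difference. *)
Lemma cliques_col a b al be :
  cliques a.+1 b.+1 al be - right_op (cliques a.+1 b) al be = (1 - q ^+ a.+1) * linked_cliques a b al be.
Proof.
rewrite /cliques /linked_cliques /right_op [clique_sum b.+1 be]clique_sum_first !mulr_sumr -sumrB;
  apply: eq_bigr => r _.
by rewrite [RHS]mulrCA -clique_sum_up; ring.
Qed.

(** The same with the last letter of the first clique peeled off; the linked pair is summed in the
    other order and [clique_sum_dn] applies. *)
Lemma cliques_row a b al be :
  cliques a.+1 b.+1 al be - left_op (cliques a b.+1) al be = (1 - q ^+ b.+1) * linked_cliques a b al be.
Proof.
have -> : linked_cliques a b al be = \sum_(p < N) al p * clique_sum a (up p al) *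
    \sum_(r < N) (r < p)%:R * (be r * clique_sum b (dn r be)).
  rewrite /linked_cliques; under eq_bigr => r _ do rewrite mulr_sumr.
  rewrite exchange_big; apply: eq_bigr => p _ /=; rewrite mulr_sumr.
  by apply: eq_bigr => r _; ring.
rewrite /cliques /left_op [clique_sum a.+1 al]clique_sumS mulr_suml mulr_sumr -sumrB;
  apply: eq_bigr => p _.
by rewrite [RHS]mulrCA -clique_sum_dn; ring.
Qed.

Lemma vert_op_cliques a b al be : vert_op (cliques a b) al be = q ^+ a * linked_cliques a b al be.
Proof.
rewrite /vert_op /domino_op /cliques /linked_cliques exchange_big mulr_sumr;
  apply: eq_bigr => r _ /=.
rewrite [RHS]mulrCA -clique_sum_above mulr_sumr; apply: eq_bigr => p _.
by ring.
Qed.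

Definition fscale (k : S) K : fctl := fun al be => k * K al be.
Definition fadd K1 K2 : fctl := fun al be => K1 al be + K2 al be.
Definition fone : fctl := fun _ _ => 1.

Lemma fctl_ext K1 K2 : (forall al be, K1 al be = K2 al be) -> K1 = K2.
Proof. by move=> E; extensionality al; extensionality be. Qed.

Definition linop (O : fctl -> fctl) := (forall k K, O (fscale k K) = fscale k (O K)) /\
  (forall K1 K2, O (fadd K1 K2) = fadd (O K1) (O K2)).

Lemma linop_right : linop right_op.
Proof.
split=> [k K|K1 K2]; apply: fctl_ext => al be;
  rewrite /right_op /fscale /fadd ?mulr_sumr -?big_split;
  by apply: eq_bigr => v _ /=; ring.
Qed.

Lemma linop_P t : linop (domino_op t).
Proof.
split=> [k K|K1 K2]; apply: fctl_ext => al be;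
  rewrite /domino_op /fscale /fadd ?mulr_sumr -?big_split;
  apply: eq_bigr => p _ /=; rewrite ?mulr_sumr -?big_split;
  by apply: eq_bigr => v _ /=; ring.
Qed.

Lemma linop_V : linop vert_op. Proof. exact: linop_P. Qed.
Lemma linop_H : linop horiz_op. Proof. exact: linop_P. Qed.

Lemma linop_iter O n : linop O -> linop (iter n O).
Proof.
move=> [O1 O2]; elim: n => [|n [IH1 IH2]] //; split=> [k K|K1 K2] /=.
  by rewrite IH1 O1.
by rewrite IH2 O2.
Qed.

Lemma iter_comm (O1 O2 : fctl -> fctl) n K :
  (forall K', O1 (O2 K') = O2 (O1 K')) -> iter n O1 (O2 K) = O2 (iter n O1 K).
Proof. by move=> C; elim: n => //= n ->. Qed.

Lemma iter_right_vert_op j K : iter j right_op (vert_op K) = fscale (q ^+ j) (vert_op (iter j right_op K)).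
Proof.
elim: j => [|j IH]; first by apply: fctl_ext => al be; rewrite /fscale mul1r.
rewrite iterS IH linop_right.1; apply: fctl_ext => al be.
by rewrite {1}/fscale right_op_vert_op /fscale mulrA -exprSr.
Qed.

Lemma right_iter_vert_op l K : right_op (iter l vert_op K) = fscale (q ^+ l) (iter l vert_op (right_op K)).
Proof.
elim: l => [|l IH]; first by apply: fctl_ext => al be; rewrite /fscale mul1r.
rewrite iterS; apply: fctl_ext => al be; rewrite right_op_vert_op IH linop_V.1.
by rewrite /fscale mulrA -exprS.
Qed.

Lemma right_iter_horiz_op h K : right_op (iter h horiz_op K) = iter h horiz_op (right_op K).
Proof. by rewrite iter_comm // => K'; apply: fctl_ext => al be; rewrite right_op_horiz_op. Qed.

Context (x : ctx).

(** The elementary symmetric polynomial e_k in the variables x_i with i < t, built from the largest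
    index so as to match the sums over r < v in [clique_sum_dn]. *)
Fixpoint elem k (t : nat) : S :=
  if k is k'.+1 then \sum_(r < N | (r < t)%N) x r * elem k' r else 1.

(** Obtained by iterating [clique_sum_dn]: every step contributes one variable below the previous
    one and one factor of [B1pow_coef]. *)
Lemma clique_sum_elem b v :
  clique_sum b (dn v x) = \sum_(k < b.+1) B1pow_coef q b k * elem k v * clique_sum (b - k) x.
Proof.
elim: b v => [|b IH] v; first by rewrite big_ord1 /B1pow_coef big_ord0 !mulr1.
rewrite -[LHS](subKr (clique_sum b.+1 x)) clique_sum_dn big_ord_recl subn0 {1}/B1pow_coef big_ord0 !mul1r.
congr (_ + _); rewrite -mulNr mulr_sumr.
under eq_bigr => r _ do rewrite IH mulrCA mulr_sumr mulr_sumr mulr_sumr.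
rewrite exchange_big; apply: eq_bigr => k _ /=; rewrite /bump /= add1n subSS.
rewrite B1pow_coef_SS mulr_sumr mulr_suml [RHS]big_mkcond; apply: eq_bigr => r _.
by rewrite add0n; case: (r < v)%N => /=; ring.
Qed.

(** The recursion of B_1^n 1 with h replaced by e; comparing it with [K_rec] identifies the
    cliques. *)
Lemma clique_sum_rec n :
  clique_sum n.+1 x = \sum_(k < n.+1) B1pow_coef q n k * elem k.+1 N * clique_sum (n - k) x.
Proof.
rewrite clique_sum_first; under eq_bigr => v _ do rewrite clique_sum_elem mulr_sumr.
rewrite exchange_big; apply: eq_bigr => k _ /=.
rewrite mulr_sumr mulr_suml; apply: eq_big => [v|v _]; first by rewrite ltn_ord.
by ring.
Qed.

Definition clique_eval l j a b : S := iter l vert_op (iter j right_op (cliques a b)) x x.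
Definition domino_eval l h j : S := iter l vert_op (iter h horiz_op (iter j right_op fone)) x x.

(** [vert_op_cliques] eliminates the linked cliques from [cliques_col]; the factor q^j comes from
    moving the vertical domino out of [j] copies of [right_op]. *)
Lemma clique_eval_col l j a b : q ^+ a * (clique_eval l j a.+1 b.+1 - clique_eval l j.+1 a.+1 b) =
  (1 - q ^+ a.+1) * q ^+ j * clique_eval l.+1 j a b.
Proof.
have E : fscale (q ^+ a) (cliques a.+1 b.+1) =
    fadd (fscale (q ^+ a) (right_op (cliques a.+1 b))) (fscale (1 - q ^+ a.+1) (vert_op (cliques a b))).
  apply: fctl_ext => al be; rewrite /fscale /fadd vert_op_cliques [(1 - _) * _]mulrCA -cliques_col.
  by ring.
have [U1 U2] := linop_iter j linop_right; have [V1 V2] : linop (iter l vert_op).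
  exact/linop_iter/linop_V.
have := congr1 (fun K => iter l vert_op (iter j right_op K) x x) E.
rewrite U1 V1 U2 V2 !U1 iter_right_vert_op !V1 -iterSr -iterSr /fscale /fadd => E'.
by rewrite mulrBr [q ^+ a * _]E' /clique_eval; ring.
Qed.

(** The linked cliques are eliminated between [cliques_col] and [cliques_row]. The resulting
    [left_op] commutes outwards and becomes a [right_op] on the diagonal. *)
Lemma clique_eval0_elim j a b : (1 - q ^+ b.+1) * clique_eval 0 j.+1 a.+1 b =
  (q ^+ a.+1 - q ^+ b.+1) * clique_eval 0 j a.+1 b.+1 + (1 - q ^+ a.+1) * clique_eval 0 j.+1 a b.+1.
Proof.
have E : fscale (1 - q ^+ b.+1) (right_op (cliques a.+1 b)) =
    fadd (fscale (q ^+ a.+1 - q ^+ b.+1) (cliques a.+1 b.+1)) (fscale (1 - q ^+ a.+1) (left_op (cliques a b.+1))).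
  apply: fctl_ext => al be; rewrite /fscale /fadd.
  rewrite -[right_op _ _ _](subKr (cliques a.+1 b.+1 al be)) cliques_col.
  by rewrite -[left_op _ _ _](subKr (cliques a.+1 b.+1 al be)) cliques_row; ring.
have [U1 U2] := linop_iter j linop_right.
have := congr1 (fun K => iter j right_op K x x) E.
rewrite U1 U2 !U1 -iterSr (iter_comm _ _ (O2 := left_op)); last first.
  by move=> K'; apply: fctl_ext => al be; rewrite left_op_right_op.
by rewrite /fscale /fadd left_op_diag -iterS.
Qed.

Lemma clique_eval_shift l j b : clique_eval l j 0 b.+1 = clique_eval l j.+1 0 b.
Proof.
rewrite /clique_eval iterSr; congr (iter l vert_op (iter j right_op _) x x);
  apply: fctl_ext => al be.
by rewrite /cliques /right_op clique_sum_first mul1r; apply: eq_bigr => v _; rewrite mul1r.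
Qed.

(** * Identification of clique and domino words with families obeying the same recursions *)

Section Identification.
Hypotheses (q_neq0 : q != 0) (q_gen : forall n, 1 - q ^+ n.+1 != 0).
Context (G : nat -> nat -> nat -> nat -> S).
Hypotheses (G0 : forall a b, G 0 0 a b = clique_sum a x * clique_sum b x)
  (Gcol : forall l j a b,
     G l j a.+1 b.+1 - G l j.+1 a.+1 b = (1 - q ^+ a.+1) * q ^+ j * G l.+1 j a b)
  (Gsym : forall l j a b, G l j a b = G l j b a)
  (Gshift : forall l j b, G l j 0 b.+1 = G l j.+1 0 b).

(** The symmetry of [G] in its last two arguments replaces the pair [cliques_col], [cliques_row]:
    [Gcol] is used for (a, b) and for (b, a). *)
Lemma G_elim j a b : (1 - q ^+ b.+1) * G 0 j.+1 a.+1 b =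
  (q ^+ a.+1 - q ^+ b.+1) * G 0 j a.+1 b.+1 + (1 - q ^+ a.+1) * G 0 j.+1 a b.+1.
Proof.
have E1 := Gcol 0 j a b; have E2 := Gcol 0 j b a.
rewrite (Gsym 0 j b.+1) (Gsym 0 j.+1 b.+1) (Gsym 1) in E2.
rewrite -[G 0 j.+1 a.+1 b](subKr (G 0 j a.+1 b.+1)) E1.
by rewrite -[G 0 j.+1 a b.+1](subKr (G 0 j a.+1 b.+1)) E2; ring.
Qed.

(** The column relation determines level l+1 from level l after division by (1 - q^(a+1)) q^j. At
    level 0 the induction is on [j] and then on [a]: the shift relation starts it and the
    elimination relation, divided by 1 - q^(b+1), continues it. *)
Lemma clique_eval_G l j a b : clique_eval l j a b = q ^+ (l * a + 'C(l, 2)) * G l j a b.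
Proof.
elim: l j a b => [|l IH] j a b; last first.
  apply: (mulfI (q_gen a)); apply: (mulfI (expf_neq0 j q_neq0)).
  rewrite !mulrA [q ^+ j * _]mulrC -clique_eval_col !IH -mulrBr Gcol binS bin1.
  by rewrite mulnS mulSn !exprD; ring.
rewrite mul1r; elim: j a b => [|j IHj] a b; first by rewrite G0.
elim: a b => [|a IHa] b; first by rewrite -clique_eval_shift IHj Gshift.
by apply: (mulfI (q_gen b)); rewrite clique_eval0_elim G_elim IHj IHa.
Qed.

Context (D : nat -> nat -> nat -> S).
Hypotheses (D0 : forall l j, D l 0 j = G l j 0 0)
  (DS : forall l h j, D l h.+1 j = D l h j.+2 - q ^+ (1 + h + j) * D l.+1 h j).

Lemma domino_eval_rec l h j : domino_eval l h.+1 j = q ^+ l * domino_eval l h j.+2 - q ^+ j.+1 * domino_eval l.+1 h j.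
Proof.
(* The innermost pair: q V + H applied to the constant 1 weighs each (p, r) by q^(r<p), exactly as
   two joined vertices do. *)
have E : iter j right_op (fadd (fscale q (vert_op fone)) (horiz_op fone)) = left_op (iter j.+1 right_op fone).
  rewrite iterSr -iter_comm; last first.
    by move=> K'; apply: fctl_ext => al be; rewrite left_op_right_op.
  congr (iter j right_op _); apply: fctl_ext => al be.
  rewrite /fadd /fscale /vert_op /horiz_op /domino_op /left_op /right_op /fone mulr_sumr -big_split.
  apply: eq_bigr => p _ /=; rewrite !mulr_sumr -big_split; apply: eq_bigr => r _ /=.
  by rewrite dnE; cmp_cases.
have [U1 U2] := linop_iter j linop_right.
have [H1 H2] : linop (iter h horiz_op) by exact/linop_iter/linop_H.
have [V1 V2] : linop (iter l vert_op) by exact/linop_iter/linop_V.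
have := congr1 (fun K => iter l vert_op (iter h horiz_op K) x x) E.
(* The outer [left_op] passes all dominoes freely, turns into [right_op] on the diagonal, and is
   moved back inside at the cost of q^l. *)
have UP t n K : iter n (domino_op t) (left_op K) = left_op (iter n (domino_op t) K).
  by apply: iter_comm => K'; apply: fctl_ext => al be; rewrite left_op_domino_op.
rewrite U2 U1 H2 V2 H1 V1 iter_right_vert_op H1 V1 !UP.
rewrite /fadd {1}/fscale left_op_diag right_iter_vert_op right_iter_horiz_op.
have -> : iter j right_op (horiz_op fone) = horiz_op (iter j right_op fone).
  by apply: iter_comm => K'; apply: fctl_ext => al be; rewrite right_op_horiz_op.
have -> : iter h horiz_op (vert_op (iter j right_op fone)) = vert_op (iter h horiz_op (iter j right_op fone)).
  by apply: iter_comm => K'; apply: fctl_ext => al be; rewrite vert_op_horiz_op.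
rewrite -!iterSr -!iterS /fscale => E'.
by rewrite /domino_eval -E' exprS; ring.
Qed.

Lemma domino_eval_D l h j : domino_eval l h j = q ^+ (l * h + 'C(l, 2)) * D l h j.
Proof.
elim: h l j => [|h IH] l j.
  rewrite D0; have := clique_eval_G l j 0 0; rewrite muln0 add0n => <-.
  congr (iter l vert_op (iter j right_op _) x x); apply: fctl_ext => al be.
  by rewrite /cliques mul1r.
rewrite domino_eval_rec !IH DS binS bin1 mulnS mulSn !exprD ?exprS; ring.
Qed.

End Identification.

Definition dominoes (s : seq bool) : fctl := foldr (fun t K => if t then vert_op K else horiz_op K) fone s.

Lemma dominoes_sorted s : dominoes s =
  iter (count_mem true s) vert_op (iter (count_mem false s) horiz_op fone).
Proof.
elim: s => [|t s IH] //; rewrite /dominoes /= -/(dominoes s) IH; case: t => //=.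
rewrite -iter_comm //= => K; apply: fctl_ext => al be; exact: vert_op_horiz_op.
Qed.

Lemma dominoes_domino_eval s : dominoes s x x = domino_eval (count_mem true s) (count_mem false s) 0.
Proof. by rewrite dominoes_sorted. Qed.

(** On the diagonal the single cell is a [right_op]; moving it inside costs q for each vertical
    domino and nothing for a horizontal one. *)
Lemma left_op_dominoes_domino_eval s : left_op (dominoes s) x x =
  q ^+ count_mem true s * domino_eval (count_mem true s) (count_mem false s) 1.
Proof. by rewrite left_op_diag dominoes_sorted right_iter_vert_op right_iter_horiz_op. Qed.

End Words.

(** * Splitting sums over words and products over pairs at one position *)

Definition finsert (T : Type) m (k : 'I_m.+1) (v : T) (f : {ffun 'I_m -> T}) :
  {ffun 'I_m.+1 -> T} := [ffun i => if unlift k i is Some j then f j else v].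

Lemma finsert_at (T : Type) m k (v : T) (f : {ffun 'I_m -> T}) : finsert k v f k = v.
Proof. by rewrite ffunE unlift_none. Qed.

Lemma finsert_lift (T : Type) m k (v : T) (f : {ffun 'I_m -> T}) i :
  finsert k v f (lift k i) = f i.
Proof. by rewrite ffunE liftK. Qed.

Lemma sum_finsert (V : nmodType) (T : finType) m (k : 'I_m.+1) (f : {ffun 'I_m.+1 -> T} -> V) :
  \sum_g f g = \sum_v \sum_(g : {ffun 'I_m -> T}) f (finsert k v g).
Proof.
rewrite pair_bigA (reindex (fun vg => finsert k vg.1 vg.2)) //=.
exists (fun g : {ffun 'I_m.+1 -> T} => (g k, [ffun i => g (lift k i)])) => [[v g]|g] _.
  by rewrite /= finsert_at; congr pair; apply/ffunP => i; rewrite ffunE finsert_lift.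
apply/ffunP => i; rewrite ffunE /=.
by case: unliftP => [j ->|->]; rewrite ?ffunE.
Qed.

Lemma lift_ord_max m (j : 'I_m) : lift ord_max j = widen_ord (leqnSn m) j.
Proof. by apply: val_inj; exact: lift_max. Qed.

Lemma prod_ord_max (R : comNzRingType) m (f : 'I_m.+1 -> R) :
  \prod_(i < m.+1) f i = (\prod_(i < m) f (lift ord_max i)) * f ord_max.
Proof. by rewrite big_ord_recr; congr (_ * _); apply: eq_bigr => i _; rewrite lift_ord_max. Qed.

Lemma prod_above_max (R : comNzRingType) m (f : 'I_m.+1 -> R) (k : 'I_m) :
  \prod_(i < m.+1 | (k < i)%N) f i =
  (\prod_(i < m | (k < i)%N) f (lift ord_max i)) * f ord_max.
Proof.
rewrite big_mkcond prod_ord_max ifT; last exact: ltn_ord.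
rewrite [X in _ = X * _]big_mkcond; congr (_ * _).
by apply: eq_bigr => i _; rewrite lift_max.
Qed.

Lemma prod_pairs_recr (R : comNzRingType) m (f : 'I_m.+1 -> 'I_m.+1 -> R) :
  \prod_(i < m.+1) \prod_(j < m.+1 | (i < j)%N) f i j =
  (\prod_(i < m) \prod_(j < m | (i < j)%N) f (lift ord_max i) (lift ord_max j)) *
  \prod_(i < m) f (lift ord_max i) ord_max.
Proof.
rewrite prod_ord_max [X in _ * X]big_pred0 => [|j]; last first.
  by apply/negbTE; rewrite -leqNgt -ltnS.
rewrite mulr1 -big_split; apply: eq_bigr => i _.
rewrite (eq_bigl (fun j : 'I_m.+1 => (i < j)%N)) ?prod_above_max // => j.
by rewrite lift_max.
Qed.

Lemma prod_pairs_recl (R : comNzRingType) m (f : 'I_m.+1 -> 'I_m.+1 -> R) :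
  \prod_(i < m.+1) \prod_(j < m.+1 | (i < j)%N) f i j =
  (\prod_(j < m) f ord0 (lift ord0 j)) *
  \prod_(i < m) \prod_(j < m | (i < j)%N) f (lift ord0 i) (lift ord0 j).
Proof.
rewrite big_ord_recl; congr (_ * _).
  by rewrite big_mkcond big_ord_recl /= mul1r.
apply: eq_bigr => i _; rewrite big_mkcond big_ord_recl /= mul1r [RHS]big_mkcond.
by apply: eq_bigr => j _.
Qed.

(** * The iterated domino operators as one sum over pairs of words *)

Section DominoExpand.
Context (S : idomainType) (q : S) (N : nat).
Local Notation I := 'I_N.

Lemma dominoes_expand m (s : nat -> bool) (al be : I -> S) : dominoes q (mkseq s m) al be =
  \sum_(P : {ffun 'I_m -> I}) \sum_(R : {ffun 'I_m -> I})
    (\prod_(i < m) ((if s i then (R i < P i)%N else (P i <= R i)%N)%:R * (al (P i) * be (R i)))) *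
    ((\prod_(i < m) \prod_(j < m | (i < j)%N) q ^+ (P j < P i)%N) *
     (\prod_(i < m) \prod_(j < m | (i < j)%N) q ^+ (R j < R i)%N) *
     (\prod_(i < m) \prod_(j < m | (i < j)%N) q ^+ (R i < P j)%N)).
Proof.
elim: m s al be => [|m IH] s al be.
  have one (f : {ffun 'I_0 -> I} -> S) g : \sum_h f h = f g.
    by rewrite (big_pred1 g) // => h; apply/esym/eqP/ffunP => -[].
  have g0 : {ffun 'I_0 -> I} by apply: finfun => -[].
  by rewrite !(one _ g0) !big_ord0 !mulr1.
have -> : mkseq s m.+1 = s 0 :: mkseq (fun i => s i.+1) m.
  by rewrite /mkseq /= (iotaDl 1 0) -map_comp.
rewrite /dominoes /= -/(dominoes q _).
have -> K : (if s 0 then vert_op q K else horiz_op q K) =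
   domino_op q (fun p r => if s 0 then (r < p)%N else (p <= r)%N) K by case: (s 0).
rewrite (sum_finsert ord0); apply: eq_bigr => p _.
under [RHS]eq_bigr => P _ do rewrite (sum_finsert ord0).
rewrite exchange_big; apply: eq_bigr => r _ /=.
rewrite IH mulr_sumr; apply: eq_bigr => P _; rewrite mulr_sumr; apply: eq_bigr => R _.
rewrite big_ord_recl !prod_pairs_recl !finsert_at /=.
have -> : \prod_(i < m) ((if s (bump 0 i) then (finsert ord0 r R (lift ord0 i) < finsert ord0 p P (lift ord0 i))%N
      else (finsert ord0 p P (lift ord0 i) <= finsert ord0 r R (lift ord0 i))%N)%:R
      * (al (finsert ord0 p P (lift ord0 i)) * be (finsert ord0 r R (lift ord0 i)))) =
    \prod_(i < m) ((if s i.+1 then (R i < P i)%N else (P i <= R i)%N)%:R * (al (P i) * be (R i))).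
  by apply: eq_bigr => i _; rewrite !finsert_lift.
have -> : \prod_j q ^+ (finsert ord0 p P (lift ord0 j) < p)%N = \prod_j q ^+ (P j < p)%N.
  by apply: eq_bigr => j _; rewrite finsert_lift.
have -> : \prod_j q ^+ (finsert ord0 r R (lift ord0 j) < r)%N = \prod_j q ^+ (R j < r)%N.
  by apply: eq_bigr => j _; rewrite finsert_lift.
have -> : \prod_j q ^+ (r < finsert ord0 p P (lift ord0 j))%N = \prod_j q ^+ (r < P j)%N.
  by apply: eq_bigr => j _; rewrite finsert_lift.
have -> : \prod_(i < m) \prod_(j < m | (i < j)%N)
      q ^+ (finsert ord0 p P (lift ord0 j) < finsert ord0 p P (lift ord0 i))%N =
    \prod_(i < m) \prod_(j < m | (i < j)%N) q ^+ (P j < P i)%N.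
  by apply: eq_bigr => i _; apply: eq_bigr => j _; rewrite !finsert_lift.
have -> : \prod_(i < m) \prod_(j < m | (i < j)%N)
      q ^+ (finsert ord0 r R (lift ord0 j) < finsert ord0 r R (lift ord0 i))%N =
    \prod_(i < m) \prod_(j < m | (i < j)%N) q ^+ (R j < R i)%N.
  by apply: eq_bigr => i _; apply: eq_bigr => j _; rewrite !finsert_lift.
have -> : \prod_(i < m) \prod_(j < m | (i < j)%N)
      q ^+ (finsert ord0 r R (lift ord0 i) < finsert ord0 p P (lift ord0 j))%N =
    \prod_(i < m) \prod_(j < m | (i < j)%N) q ^+ (R i < P j)%N.
  by apply: eq_bigr => i _; apply: eq_bigr => j _; rewrite !finsert_lift.
have -> : \prod_(i < m) ((if s i.+1 then (R i < P i)%N else (P i <= R i)%N)%:R *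
      (up q r (dn q p al) (P i) * dn q r be (R i))) =
    \prod_(i < m) ((if s i.+1 then (R i < P i)%N else (P i <= R i)%N)%:R * (al (P i) * be (R i)))
    * (\prod_j q ^+ (P j < p)%N * \prod_j q ^+ (R j < r)%N * \prod_j q ^+ (r < P j)%N).
  by rewrite -!big_split; apply: eq_bigr => i _ /=; rewrite /up /dn; ring.
by ring.
Qed.

End DominoExpand.

Lemma prod_nat_bool (R : comNzRingType) (T : finType) (b : T -> bool) :
  \prod_j (b j)%:R = [forall j, b j]%:R :> R.
Proof.
case: forallP => [bT|bF]; first by rewrite big1 // => j _; rewrite bT.
have /forallPn[j bj] : ~~ [forall j, b j] by apply/negP => /forallP.
by rewrite (bigD1 j) //= (negbTE bj) mul0r.
Qed.

(** * Cells, fillings and inversions of a tuple of dominoes followed by single cells *)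

Section DominoLLT.
Context (d m : nat) (md : (m <= d)%N) (lam : d.-tuple skew_diagram) (s : nat -> bool).
Hypotheses (lam_domino : forall i : 'I_d, (i < m)%N ->
    if s i then vertical_domino01 (tnth lam i) else horizontal_domino01 (tnth lam i))
  (lam_single : forall i : 'I_d, (m <= i)%N -> single_cell0 (tnth lam i)).

(** A domino has one cell of each content 0 and 1, so the content selects the cell; the default is
    reached only when the component has no cell of content [k]. *)
Definition cell (k : int) (i : 'I_d) : nat * nat :=
  head (0, 0)%N [seq x <- cells (tnth lam i) | content x == k].

Lemma cell_eq k i u : u \in cells (tnth lam i) -> content u = k ->
  (forall x, x \in cells (tnth lam i) -> content x = k -> x = u) -> cell k i = u.
Proof.
move=> ui uk uniq; rewrite /cell; set t := filter _ _.
have ut : u \in t by rewrite mem_filter uk eqxx.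
have : head (0, 0)%N t \in t by case: (t) ut => // x t' _; rewrite mem_head.
by rewrite mem_filter => /andP[/eqP E xi]; apply: uniq.
Qed.

Lemma domino_cells (i : 'I_d) : (i < m)%N ->
  [/\ cells (tnth lam i) =i [:: cell 0 i; cell 1 i], content (cell 0 i) = 0,
      content (cell 1 i) = 1 &
      if s i then (cell 0 i).2 = (cell 1 i).2 /\ (cell 0 i).1 = (cell 1 i).1.+1
      else (cell 0 i).1 = (cell 1 i).1 /\ (cell 1 i).2 = (cell 0 i).2.+1].
Proof.
move=> im; have := lam_domino im; case: (s i) => -[r [c [cE k1 k2]]].
  have c1 : cell 1 i = (r, c).
    apply: cell_eq => //; first by rewrite cE mem_head.
    by move=> x; rewrite cE !inE => /orP[] /eqP -> //; rewrite k2.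
  have c0 : cell 0 i = (r.+1, c).
    apply: cell_eq => //; first by rewrite cE !inE eqxx orbT.
    by move=> x; rewrite cE !inE => /orP[] /eqP -> //; rewrite k1.
  by rewrite c0 c1; split=> // x; rewrite cE !inE orbC.
have c0 : cell 0 i = (r, c).
  apply: cell_eq => //; first by rewrite cE mem_head.
  by move=> x; rewrite cE !inE => /orP[] /eqP -> //; rewrite k2.
have c1 : cell 1 i = (r, c.+1).
  apply: cell_eq => //; first by rewrite cE !inE eqxx orbT.
  by move=> x; rewrite cE !inE => /orP[] /eqP -> //; rewrite k1.
by rewrite c0 c1; split=> // x; rewrite cE !inE.
Qed.

Lemma single_cells (i : 'I_d) : (m <= i)%N ->
  cells (tnth lam i) =i [:: cell 0 i] /\ content (cell 0 i) = 0.
Proof.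
move=> /lam_single[r [c [cE k]]].
have c0 : cell 0 i = (r, c).
  apply: cell_eq => //; first by rewrite cE mem_head.
  by move=> x; rewrite cE !inE => /eqP.
by rewrite c0.
Qed.

Lemma content_cell0 i : content (cell 0 i) = 0.
Proof. by case: (ltnP i m) => [/domino_cells[]|/single_cells[]]. Qed.

Definition wid (j : 'I_m) : 'I_d := widen_ord md j.

Lemma content_cell1 j : content (cell 1 (wid j)) = 1.
Proof. by have [] := @domino_cells (wid j) (ltn_ord j). Qed.

(** All cells are indexed by a disjoint sum: [inl i] for the content-0 cell of any component,
    [inr j] for the content-1 cell of a domino. *)
Definition position (u : 'I_d + 'I_m) : 'I_d * (nat * nat) :=
  match u with inl i => (i, cell 0 i) | inr j => (wid j, cell 1 (wid j)) end.

Lemma position_tcells u : position u \in tcells lam.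
Proof.
case: u => [i|j]; apply/allpairsPdep.
  exists i, (cell 0 i); rewrite mem_enum; split=> //.
  by case: (ltnP i m) => [/domino_cells[-> _ _ _]|/single_cells[-> _]]; rewrite mem_head.
exists (wid j), (cell 1 (wid j)); rewrite mem_enum; split=> //.
by have [-> _ _ _] := @domino_cells (wid j) (ltn_ord j); rewrite !inE eqxx orbT.
Qed.

Definition cell_at (u : 'I_d + 'I_m) : tcell lam := SeqSub (position_tcells u).

Lemma comp_cell_at u : Defs.comp (cell_at u) = match u with inl i => i | inr j => wid j end.
Proof. by case: u. Qed.

Lemma content_cell_at u :
  content (val (cell_at u)).2 = match u with inl _ => 0 | inr _ => 1 end.
Proof. by case: u => [i|j]; [exact: content_cell0|exact: content_cell1]. Qed.

Lemma cell_at_inj : injective cell_at.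
Proof.
move=> u v E; have := congr1 (@Defs.comp _ lam) E; rewrite !comp_cell_at.
have := congr1 (fun x : tcell lam => content (val x).2) E;
  rewrite /= -!/(val (cell_at _)) !content_cell_at.
case: u v {E} => [i|j] [i'|j'] //= _; first by move->.
by move=> /(congr1 val) /= jj; congr inr; apply: val_inj.
Qed.

Lemma cell_at_surj x : exists u, cell_at u = x.
Proof.
case: x => -[i y] xP; have /allpairsPdep[i' [y' [_ y'i [E1 E2]]]] := xP.
case: (ltnP i m) => im.
  have [cE _ _ _] := domino_cells im; move: y'i; rewrite -E1 -E2 cE !inE => /orP[]/eqP yE.
    by exists (inl i); apply: val_inj; rewrite /= yE.
  exists (inr (Ordinal im)); apply: val_inj; rewrite /= yE.
  by have -> : wid (Ordinal im) = i by apply: val_inj.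
have [cE _] := single_cells im; move: y'i; rewrite -E1 -E2 cE !inE => /eqP yE.
by exists (inl i); apply: val_inj; rewrite /= yE.
Qed.

Lemma cell_at_bij : bijective cell_at.
Proof.
apply: inj_card_bij; first exact: cell_at_inj.
rewrite -(card_image cell_at_inj xpredT) subset_leq_card //.
apply/subsetP => x _; have [u <-] := cell_at_surj x.
exact: image_f.
Qed.

Lemma shifted_content_cell_at u : shifted_content (cell_at u) =
  match u with inl i => (i : nat)%:Z | inr j => (d + j)%N%:Z end.
Proof.
rewrite /shifted_content content_cell_at comp_cell_at.
by case: u => [i|j] /=; lia.
Qed.

Context (F : fieldType) (q : F) (N : nat).
Local Notation I := 'I_N.

Let ltnSnn n : (n.+1 < n)%N = false.
Proof. by apply/negbTE; rewrite -leqNgt leqnSn. Qed.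

Lemma semistandardE (T : {ffun tcell lam -> I}) :
  semistandard T = [forall j : 'I_m, if s j
     then (T (cell_at (inr j)) < T (cell_at (inl (wid j))))%N
     else (T (cell_at (inl (wid j))) <= T (cell_at (inr j)))%N].
Proof.
apply/forallP/forallP => [ss j|ss x].
  have [_ _ _ rel] := @domino_cells (wid j) (ltn_ord j).
  move: rel; rewrite [s (wid j)]/=; case: (s j) => -[r1 r2].
    have /forallP/(_ (cell_at (inl (wid j)))) := ss (cell_at (inr j)).
    rewrite !comp_cell_at eqxx => /andP[_ /implyP]; apply.
    by rewrite /col_of /row_of /= r1 r2 eqxx ltnSn.
  have /forallP/(_ (cell_at (inr j))) := ss (cell_at (inl (wid j))).
  rewrite !comp_cell_at eqxx => /andP[/implyP + _]; apply.
  by rewrite /col_of /row_of /= r1 r2 eqxx ltnSn.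
apply/forallP => y; apply/implyP.
have [u <-] := cell_at_surj x; have [v <-] := cell_at_surj y.
rewrite !comp_cell_at /row_of /col_of /=.
case: u v => [i|j] [i'|j'] /= /eqP E.
- by rewrite E !ltnn !andbF.
- have [_ _ _ rel] := @domino_cells (wid j') (ltn_ord j').
  move: rel (ss j'); rewrite E [s (wid j')]/=; case: (s j') => -[r1 r2] H.
    by rewrite r1 r2 ltnn ltnSnn !andbF.
  by rewrite H r1 r2 ltnn andbF !implybT.
- have [_ _ _ rel] := @domino_cells (wid j) (ltn_ord j).
  move: rel (ss j); rewrite -E [s (wid j)]/=; case: (s j) => -[r1 r2] H.
    by rewrite H r1 r2 ltnn andbF !implybT.
  by rewrite r1 r2 ltnn ltnSnn !andbF.
- by rewrite E !ltnn !andbF.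
Qed.

Lemma Inv_weight (T : {ffun tcell lam -> I}) (S : comNzRingType) (t : S) :
  t ^+ #|Inv T| =
  (\prod_(i < d) \prod_(i' < d | (i < i')%N) t ^+ (T (cell_at (inl i')) < T (cell_at (inl i)))%N)
  * (\prod_(j < m) \prod_(j' < m | (j < j')%N) t ^+ (T (cell_at (inr j')) < T (cell_at (inr j)))%N)
  * (\prod_(j < m) \prod_(i < d | (j < i)%N) t ^+ (T (cell_at (inr j)) < T (cell_at (inl i)))%N).
Proof.
rewrite -sum1_card big_mkcond /= expr_sum.
transitivity (\prod_x \prod_y t ^+ (if (x, y) \in Inv T then 1 else 0)).
  by rewrite pair_bigA; apply: eq_bigr => -[].
rewrite (reindex cell_at) /=; last exact/onW_bij/cell_at_bij.
under eq_bigr => u _.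
  rewrite (reindex cell_at) /=; last exact/onW_bij/cell_at_bij.
  rewrite big_sumType /=; over.
rewrite big_sumType /= !big_split /= [X in _ * X]mulrC mulrA.
(* From a content-1 cell to a content-0 cell the shifted content decreases, so such pairs contribute
   nothing. *)
rewrite [X in _ * X]big1 ?mulr1; last first.
  move=> j _; rewrite big1 // => i _; rewrite inE !shifted_content_cell_at /=.
  by rewrite ifF //; have := ltn_ord i; lia.
rewrite mulrAC; congr (_ * _ * _).
- apply: eq_bigr => i _; rewrite [RHS]big_mkcond; apply: eq_bigr => i' _.
  rewrite inE !shifted_content_cell_at /=.
  have -> : (0 < (i' : nat)%:Z - (i : nat)%:Z < d%:Z)%R = (i < i')%N.
    by have := ltn_ord i'; lia.
  by case: (i < i')%N; case: (_ < _)%N.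
- apply: eq_bigr => i _; rewrite [RHS]big_mkcond; apply: eq_bigr => i' _.
  rewrite inE !shifted_content_cell_at /=.
  have -> : (0 < (d + i')%N%:Z - (d + i)%N%:Z < d%:Z)%R = (i < i')%N.
    by have := ltn_ord i'; lia.
  by case: (i < i')%N; case: (_ < _)%N.
rewrite exchange_big; apply: eq_bigr => j _; rewrite [RHS]big_mkcond; apply: eq_bigr => i _ /=.
rewrite inE !shifted_content_cell_at /=.
have -> : (0 < (d + j)%N%:Z - (i : nat)%:Z < d%:Z)%R = (j < i)%N.
  by have := ltn_ord i; have := ltn_ord j; lia.
by case: (j < i)%N; case: (_ < _)%N.
Qed.

Local Notation S := (mpoly.mpoly N F).

Lemma LLT_expand : LLT q lam N =
  \sum_(P : {ffun 'I_d -> I}) \sum_(R : {ffun 'I_m -> I})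
    (\prod_(i < d) 'X_(P i) *
     \prod_(j < m) ((if s j then (R j < P (wid j))%N else (P (wid j) <= R j)%N)%:R * 'X_(R j))) *
    ((\prod_(i < d) \prod_(i' < d | (i < i')%N) (mpoly.mpolyC N q) ^+ (P i' < P i)%N) *
     (\prod_(j < m) \prod_(j' < m | (j < j')%N) (mpoly.mpolyC N q) ^+ (R j' < R j)%N) *
     (\prod_(j < m) \prod_(i < d | (j < i)%N) (mpoly.mpolyC N q) ^+ (R j < P i)%N)).
Proof.
have [g gK Kg] := cell_at_bij.
(* A filling is the same as a word [P] on the content-0 cells and a word [R] on the content-1
   cells. *)
pose glue (PR : {ffun 'I_d -> I} * {ffun 'I_m -> I}) : {ffun tcell lam -> I} :=
  [ffun x => match g x with inl i => PR.1 i | inr j => PR.2 j end].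
have glue0 PR i : glue PR (cell_at (inl i)) = PR.1 i by rewrite ffunE gK.
have glue1 PR j : glue PR (cell_at (inr j)) = PR.2 j by rewrite ffunE gK.
rewrite /LLT big_mkcond (reindex glue) /=; last first.
  exists (fun T : {ffun tcell lam -> I} =>
      ([ffun i => T (cell_at (inl i))], [ffun j => T (cell_at (inr j))])) => [[P R]|T] _.
    by congr pair; apply/ffunP => i; rewrite ffunE ?glue0 ?glue1.
  by apply/ffunP => x; rewrite ffunE -[x in RHS]Kg; case: (g x) => i; rewrite ffunE.
rewrite pair_bigA; apply: eq_bigr => -[P R] _ /=.
have -> : \prod_x 'X_(glue (P, R) x) = \prod_(i < d) 'X_(P i) * \prod_(j < m) 'X_(R j) :> S.
  rewrite (reindex cell_at) /=; last exact/onW_bij/cell_at_bij.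
  rewrite big_sumType /=; congr (_ * _); apply: eq_bigr => i _; first by rewrite glue0.
  by rewrite glue1.
rewrite -mul_mpolyC rmorphXn /= Inv_weight semistandardE big_split /= prod_nat_bool.
have -> : [forall j : 'I_m, if s j
     then (glue (P, R) (cell_at (inr j)) < glue (P, R) (cell_at (inl (wid j))))%N
     else (glue (P, R) (cell_at (inl (wid j))) <= glue (P, R) (cell_at (inr j)))%N] =
  [forall j : 'I_m, if s j then (R j < P (wid j))%N else (P (wid j) <= R j)%N].
  by apply: eq_forallb => j; rewrite glue0 glue1.
set b := [forall j, _].
set E1 := \prod_(i < d) \prod_(i' < d | (i < i')%N) _.
set E2 := \prod_(j < m) \prod_(j' < m | (j < j')%N) _.
set E3 := \prod_(j < m) \prod_(j' < d | (j < j')%N) _.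
set E1' := \prod_(i < d) \prod_(i' < d | (i < i')%N) (mpoly.mpolyC N q) ^+ (P i' < P i)%N.
set E2' := \prod_(j < m) \prod_(j' < m | (j < j')%N) (mpoly.mpolyC N q) ^+ (R j' < R j)%N.
set E3' := \prod_(j < m) \prod_(i < d | (j < i)%N) (mpoly.mpolyC N q) ^+ (R j < P i)%N.
have -> : E1 = E1' by apply: eq_bigr => i _; apply: eq_bigr => i' _; rewrite !glue0.
have -> : E2 = E2' by apply: eq_bigr => i _; apply: eq_bigr => i' _; rewrite !glue1.
have -> : E3 = E3' by apply: eq_bigr => i _; apply: eq_bigr => i' _; rewrite glue0 glue1.
by case: b => /=; ring.
Qed.

End DominoLLT.

(** * The two LLT polynomials of the theorem as words in the operators *)

Section LLTDominoes.
Context (m : nat) (s : nat -> bool) (F : fieldType) (q : F) (N : nat).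
Local Notation I := 'I_N.
Local Notation S := (mpoly.mpoly N F).
Local Notation qS := (@mpoly.mpolyC N F q).
Local Notation X := (fun i : 'I_N => mpolyX F U_(i)).

Lemma LLT_even (lam : m.-tuple skew_diagram)
  (lam_domino : forall i : 'I_m,
    if s i then vertical_domino01 (tnth lam i) else horizontal_domino01 (tnth lam i)) :
  LLT q lam N = dominoes qS (mkseq s m) X X.
Proof.
rewrite (@LLT_expand m m (leqnn m) lam s) => [|i _|i]; last 2 first.
- exact: lam_domino.
- by rewrite leqNgt ltn_ord.
have widE (j : 'I_m) : wid (leqnn m) j = j by apply: val_inj.
rewrite dominoes_expand; apply: eq_bigr => P _; apply: eq_bigr => R _; congr (_ * _).
by rewrite -big_split; apply: eq_bigr => i _ /=; rewrite widE; ring.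
Qed.

(** The single cell has shifted content m with d = m + 1: it follows the other content-0 cells and
    lies at distance j + 1 < d before the content-1 cell of component j, hence is joined to
    everything. *)
Lemma LLT_odd (lam : m.+1.-tuple skew_diagram)
  (lam_domino : forall i : 'I_m.+1, (i < m)%N ->
    if s i then vertical_domino01 (tnth lam i) else horizontal_domino01 (tnth lam i))
  (lam_single : single_cell0 (tnth lam ord_max)) :
  LLT q lam N = left_op qS (dominoes qS (mkseq s m)) X X.
Proof.
rewrite (@LLT_expand m.+1 m (leqnSn m) lam s lam_domino) => [|i mi]; last first.
  by have -> : i = ord_max by apply: val_inj; apply/eqP; rewrite eqn_leq mi -ltnS ltn_ord.
rewrite (sum_finsert ord_max) /left_op; apply: eq_bigr => v _.
rewrite dominoes_expand mulr_sumr; apply: eq_bigr => P _; rewrite mulr_sumr; apply: eq_bigr => R _.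
have widE (j : 'I_m) : wid (leqnSn m) j = lift ord_max j by rewrite lift_ord_max.
rewrite prod_ord_max prod_pairs_recr finsert_at.
under [X in _ * (_ * X)]eq_bigr => j _ do rewrite prod_above_max finsert_at.
rewrite [X in _ * (_ * X)]big_split.
have -> : \prod_(i < m) 'X_(finsert ord_max v P (lift ord_max i)) = \prod_(i < m) 'X_(P i) :> S.
  by apply: eq_bigr => i _; rewrite finsert_lift.
have -> : \prod_(j < m) ((if s j then (R j < finsert ord_max v P (wid (leqnSn m) j))%N
     else (finsert ord_max v P (wid (leqnSn m) j) <= R j)%N)%:R * 'X_(R j)) =
    \prod_(j < m) ((if s j then (R j < P j)%N else (P j <= R j)%N)%:R * 'X_(R j)) :> S.
  by apply: eq_bigr => j _; rewrite widE finsert_lift.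
have -> : \prod_(i < m) \prod_(j < m | (i < j)%N)
     qS ^+ (finsert ord_max v P (lift ord_max j) < finsert ord_max v P (lift ord_max i))%N =
   \prod_(i < m) \prod_(j < m | (i < j)%N) qS ^+ (P j < P i)%N.
  by apply: eq_bigr => i _; apply: eq_bigr => j _; rewrite !finsert_lift.
have -> : \prod_(i < m) qS ^+ (v < finsert ord_max v P (lift ord_max i))%N =
   \prod_(i < m) qS ^+ (v < P i)%N.
  by apply: eq_bigr => i _; rewrite finsert_lift.
have -> : \prod_(j < m) \prod_(i < m | (j < i)%N)
     qS ^+ (R j < finsert ord_max v P (lift ord_max i))%N =
   \prod_(j < m) \prod_(i < m | (j < i)%N) qS ^+ (R j < P i)%N.
  by apply: eq_bigr => i _; apply: eq_bigr => j _; rewrite !finsert_lift.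
have -> : \prod_(i < m) ((if s i then (R i < P i)%N else (P i <= R i)%N)%:R *
      (up qS v X (P i) * dn qS v X (R i))) =
   \prod_(i < m) 'X_(P i) * \prod_(i < m) ((if s i then (R i < P i)%N else (P i <= R i)%N)%:R * 'X_(R i)) *
   \prod_(i < m) qS ^+ (v < P i)%N * \prod_(i < m) qS ^+ (R i < v)%N.
  by rewrite -!big_split; apply: eq_bigr => i _ /=; rewrite /up /dn; ring.
by rewrite ?big_split /=; ring.
Qed.

End LLTDominoes.

(** * Formal properties of adjoints under a nondegenerate symmetric form *)

Section Adjoint.
Context (F : fieldType) (L : comAlgType F) (form : L -> L -> F) (adj : L -> L -> L).
Hypotheses (formDl : forall f1 f2 g, form (f1 + f2) g = form f1 g + form f2 g)
  (formZl : forall c f g, form (c *: f) g = c * form f g)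
  (formC : forall f g, form f g = form g f)
  (form_nondegenerate : forall f, (forall g, form f g = 0) -> f = 0)
  (form_adj : forall f u v, form (adj f u) v = form u (f * v)).

Lemma form_inj f g : (forall v, form f v = form g v) -> f = g.
Proof.
move=> fg; apply/eqP; rewrite -subr_eq0; apply/eqP/form_nondegenerate => v.
by rewrite formDl -scaleN1r formZl fg mulN1r subrr.
Qed.

Lemma adj_linear f : linear (adj f).
Proof.
by move=> c u v; apply: form_inj => w; rewrite formDl formZl !form_adj formDl formZl.
Qed.

Lemma adj_linearl u : linear (adj ^~ u).
Proof.
move=> c f g; apply: form_inj => w; rewrite formDl formZl !form_adj !(formC u).
by rewrite mulrDl -scalerAl formDl formZl.
Qed.

Lemma adjM f g u : adj (f * g) u = adj f (adj g u).
Proof. by apply: form_inj => w; rewrite !form_adj mulrA [g * f]mulrC. Qed.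

Lemma adj1 u : adj 1 u = u.
Proof. by apply: form_inj => w; rewrite form_adj mul1r. Qed.

End Adjoint.

Lemma twisted_linear (F : fieldType) (L : comAlgType F) (T : L -> L) (k : F) (x : L) :
  linear T -> forall c f g, T (x * f) = k *: f + x * T f -> T (x * g) = k *: g + x * T g ->
  T (x * (c *: f + g)) = k *: (c *: f + g) + x * T (c *: f + g).
Proof.
move=> lin c f g Hf Hg; rewrite mulrDr -scalerAr !lin Hf Hg.
by rewrite !scalerDr mulrDr addrACA -scalerAr !scalerA [c * k]mulrC.
Qed.

(* Unifying << m1 >> with << m2 >> otherwise unfolds {malg} and does not terminate
   in practice; most of what follows is stated over an abstract algebra L for the
   same reason. *)
#[local] Opaque monalg.mkmalgU monalg.mcoeff monalg.msupp ucm mulcm divcm.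

(** * The operators adjoint to power sums as derivations *)

Section Perp.
Context (F : fieldType) (F0 : [pchar F] =i pred0).
Local Notation Lam := (Sym F).
Implicit Types f g u v : Lam.

Lemma malgUZ (c : F) (m : {cmonom nat}) : << c *g m >> = c *: << m >> :> Lam.
Proof.
rewrite -monalg.mul_malgC monalg.malgM_def.
by apply: etrans (esym (monalg.fgmulUU _ _ _ _)); rewrite mulr1 mul1m.
Qed.

Lemma Sym_span (P : Lam -> Prop) : (forall c f g, P f -> P g -> P (c *: f + g)) ->
  (forall m, P << m >>) -> forall f, P f.
Proof.
move=> PL PU f.
(* Zero is reached as -1 + 1, since closure is only assumed for combinations of the form c f + g. *)
have P0 : P 0 by have := PL (-1) _ _ (PU mone) (PU mone); rewrite scaleN1r addNr.
rewrite (monalg.monalgE f); apply: (big_ind P) => [|x y Px Py|m _].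
- exact: P0.
- by have := PL 1 x y Px Py; rewrite scale1r.
have := PL (monalg.mcoeff m f) _ _ (PU m) P0; rewrite addr0.
by move=> H; exact: (eq_ind_r P H (malgUZ (monalg.mcoeff m f) m)).
Qed.

Lemma psumM j (m : {cmonom nat}) : psum F j * << m >> = << mulcm (ucm j) m >>.
Proof. by rewrite /psum monalg.malgM_def monalg.fgmulUU mulr1. Qed.

Lemma mulcmUK i (m : {cmonom nat}) : (0 < m i)%N -> mulcm (ucm i) (divcm m (ucm i)) = m.
Proof.
move=> mi; apply/eqP/cmP => j; rewrite mulcmE divcmE cmU.
by case: (i =P j) => [<-|_] /=; rewrite ?subnKC // subn0.
Qed.

(** The power sums generate the algebra; a monomial other than 1 loses weight when one power sum is
    split off. *)
Lemma Sym_ind (P : Lam -> Prop) : (forall c f g, P f -> P g -> P (c *: f + g)) ->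
  P 1 -> (forall i f, P f -> P (psum F i * f)) -> forall f, P f.
Proof.
move=> PL P1 PM; apply: Sym_span PL _ => m.
move: {2}(weight m) (erefl (weight m)) => n.
elim/ltn_ind: n m => n IH m mn.
case: (fset_0Vmem (finsupp m)) => [m0|[i im]].
  have -> : m = mone by apply/eqP/cmP => i; rewrite cm1; apply/eqP; rewrite cmE_eq0 m0 in_fset0.
  exact: P1.
have mi : (0 < m i)%N by rewrite lt0n cmE_neq0.
rewrite -(mulcmUK mi) -psumM; apply: PM; apply: (IH (weight (divcm m (ucm i)))) => //.
by rewrite -mn -{2}(mulcmUK mi) weightM weightU addSn ltnS leq_addl.
Qed.

Lemma zeeEw (d : {fset nat}) (m : {cmonom nat}) : (finsupp m `<=` d)%fset ->
  zee F m = (\prod_(i <- d) (i.+1 ^ m i * (m i)`!))%:R.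
Proof.
move=> le; rewrite /zee (big_fset_incl _ le) //.
by move=> i _; rewrite -cmE_neq0 negbK => /eqP ->.
Qed.

Lemma zee_mulU i (m : {cmonom nat}) :
  zee F (mulcm (ucm i) m) = (i.+1 * (m i).+1)%:R * zee F m.
Proof.
have sub : (finsupp m `<=` i |` finsupp m)%fset by exact: fsubsetUr.
rewrite (zeeEw sub) (@zeeEw (i |` finsupp m)%fset); last first.
  by rewrite (mdomD (ucm i) m) mdomU.
rewrite -natrM; congr (_%:R); have ii : i \in (i |` finsupp m)%fset by exact: fset1U1.
rewrite !(big_fsetD1 i ii) /= mulcmE cmUU add1n expnS factS.
rewrite (eq_big_seq (fun j => (j.+1 ^ m j * (m j)`!)%N)) => [|j].
  by rewrite !mulnA; congr muln; rewrite -!mulnA; congr muln; rewrite mulnCA.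
by rewrite in_fsetD1 mulcmE cmU eq_sym => /andP[/negbTE -> _].
Qed.

Lemma perp_U (m1 m2 : {cmonom nat}) : perp (<< m1 >> : Lam) << m2 >> = perp_mon F m1 m2.
Proof.
have s1 := monalg.msuppU1 F m1; have s2 := monalg.msuppU1 F m2.
have c1 := monalg.mcoeffUU m1 (1 : F); have c2 := monalg.mcoeffUU m2 (1 : F).
rewrite /perp; pattern (monalg.msupp (<< m1 >> : Lam)).
apply: (eq_ind_r _ _ s1); pattern (monalg.msupp (<< m2 >> : Lam)).
by apply: (eq_ind_r _ _ s2); rewrite 2!big_seq_fset1 c1 c2 mulr1 scale1r.
Qed.

(** This is (i+1) times the partial derivative in p_(i+1), read off from the ratio of the two
    z-factors. *)
Lemma perp_psumU i (m : {cmonom nat}) :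
  perp (psum F i) << m >> = (i.+1 * m i)%:R *: << divcm m (ucm i) >>.
Proof.
rewrite /psum perp_U /perp_mon; case: eqP => [mE|mN]; last first.
  suff -> : m i = 0%N by rewrite muln0 scale0r.
  by apply/eqP; rewrite -leqn0 leqNgt; apply/negP => mi; apply: mN; rewrite mulcmUK.
have mi : m i = (divcm m (ucm i) i).+1 by rewrite {1}mE mulcmE cmUU.
have -> : zee F m / zee F (divcm m (ucm i)) = (i.+1 * m i)%:R.
  by rewrite {1}mE zee_mulU mulfK ?zee_neq0 // -mi.
exact: malgUZ.
Qed.

Lemma perp_linear f : linear (perp f).
Proof. exact: (adj_linear (@hallDl F) (@hallZl F) (hall_nondegenerate F0) (hall_perp F0)). Qed.

Lemma perp_linearl u : linear (fun f : Lam => perp f u).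
Proof.
exact: (adj_linearl (@hallDl F) (@hallZl F) (@hallC F) (hall_nondegenerate F0) (hall_perp F0)).
Qed.

Lemma perpM f g u : perp (f * g) u = perp f (perp g u).
Proof. exact: (adjM (@hallDl F) (@hallZl F) (hall_nondegenerate F0) (hall_perp F0)). Qed.

Lemma perp1 u : perp 1 u = u.
Proof. exact: (adj1 (@hallDl F) (@hallZl F) (hall_nondegenerate F0) (hall_perp F0)). Qed.

Lemma perp_psumM i j f : perp (psum F i) (psum F j * f) =
  ((i == j) * i.+1)%:R *: f + psum F j * perp (psum F i) f.
Proof.
have lin := perp_linear (psum F i).
move: f; apply: Sym_span => [c f g|m]; first exact: twisted_linear.
apply: (etrans (congr1 (perp (psum F i)) (psumM j m))).
apply: (etrans (perp_psumU i (mulcm (ucm j) m))).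
pose c : F := ((i == j) * i.+1)%:R.
apply: (@etrans _ _ (c *: << m >> + (i.+1 * m i)%:R *: << mulcm (ucm j) (divcm m (ucm i)) >>));
  last first.
  apply: (congr1 (fun x => c *: << m >> + x));
    apply: (etrans _ (congr1 (fun x => psum F j * x) (esym (perp_psumU i m)))).
  by apply: (etrans (congr1 (fun x => (i.+1 * m i)%:R *: x) (esym (psumM j (divcm m (ucm i))))));
    rewrite scalerAr.
rewrite {}/c.
have -> : mulcm (ucm j) m i = ((i == j) + m i)%N by rewrite mulcmE cmU eq_sym.
case: (i =P j) => [<-|ij]; last first.
  rewrite mul0n scale0r add0r add0n; congr (_ *: << _ >>).
  apply/eqP/cmP => k; rewrite divcmE !mulcmE divcmE !cmU.
  by case: (i =P k) => [<-|_]; rewrite ?subn0 //; case: (j =P i) => // /esym.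
rewrite mul1n add1n.
have -> : divcm (mulcm (ucm i) m) (ucm i) = m.
  by apply/eqP/cmP => k; rewrite divcmE mulcmE addKn.
(* When p_(i+1) does not occur in [m] the truncated quotient is not a true one, but its coefficient
   is zero. *)
case: (posnP (m i)) => [->|mi]; first by rewrite muln0 scale0r addr0 muln1.
by rewrite mulcmUK // -scalerDl -natrD mulnS.
Qed.

Lemma perp_psum1 i : perp (psum F i) 1 = 0.
Proof. by apply: (etrans (perp_psumU i mone)); rewrite cm1 muln0 scale0r. Qed.

Lemma perp_eh_eq0 f r j : (xdeg f < r + j)%N -> perp (e_ F r * h_ F j) f = 0.
Proof.
move=> fr; apply: perp_eq0 => m.
rewrite monalg.mcoeff_neq0 => /(fsubsetP (msuppM_incl _ _)) /imfset2P[k1 /= k1r [k2 k2j ->]].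
have w1 : weight k1 = r by apply: (@newton_weight F (-1)); rewrite monalg.mcoeff_neq0.
have w2 : weight k2 = j by apply: (@newton_weight F 1); rewrite monalg.mcoeff_neq0.
by rewrite weightM w1 w2.
Qed.

End Perp.

Lemma sum_ord_stable (V : nmodType) (f : nat -> V) m n :
  (forall i, (m <= i)%N -> f i = 0) -> (forall i, (n <= i)%N -> f i = 0) ->
  \sum_(i < m) f i = \sum_(i < n) f i.
Proof.
wlog mn : m n / (m <= n)%N => [H fm fn|fm fn].
  by case: (leqP m n) => [/H->//|/ltnW/H->].
rewrite -!(big_mkord xpredT f) [RHS](big_cat_nat (n := m)) //=.
by rewrite [X in _ + X]big_nat_cond [X in _ + X]big1 ?addr0 // => i /andP[/andP[/fm]].
Qed.

(** * The operators B_a in terms of theta_k *)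

Section SymmetricFunctionOperators.
Context (F : fieldType) (F0 : [pchar F] =i pred0) (L : comAlgType F) (q : F).
Context (p h e : nat -> L) (perp : L -> L -> L) (deg : L -> nat) (B : int -> L -> L).

Definition zext (a : int) : L := if a is Posz r then h r else 0.

Hypotheses (perp_lin : forall f, linear (perp f))
  (perp_linl : forall u, linear (fun f => perp f u))
  (perpM : forall f g u, perp (f * g) u = perp f (perp g u))
  (perp1 : forall u, perp 1 u = u)
  (L_ind : forall P : L -> Prop, (forall c f g, P f -> P g -> P (c *: f + g)) ->
     P 1 -> (forall i f, P f -> P (p i * f)) -> forall f, P f)
  (perp_p1 : forall i, perp (p i) 1 = 0)
  (perp_pp : forall i j f, perp (p i) (p j * f) =
     ((i == j) * i.+1)%:R *: f + p j * perp (p i) f)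
  (h0 : h 0 = 1) (e0 : e 0 = 1)
  (hS : forall n, h n.+1 =
     n.+1%:R^-1 *: \sum_(i < n.+1) 1 ^+ i *: (p i * h (n - i)%N))
  (eS : forall n, e n.+1 =
     n.+1%:R^-1 *: \sum_(i < n.+1) (-1) ^+ i *: (p i * e (n - i)%N))
  (perp_eh0 : forall f r j, (deg f < r + j)%N -> perp (e r * h j) f = 0)
  (Bdef : forall a f, B a f = \sum_(j < (deg f).+1) q ^+ j *:
     \sum_(r < (deg (perp (h j) f)).+1)
        (-1) ^+ r *: (zext (a + j%:Z + r%:Z) * perp (e r) (perp (h j) f))).

HB.instance Definition _ f := GRing.isLinear.Build F L L *:%R (perp f) (perp_lin f).

Let nz n : n.+1%:R != 0 :> F.
Proof. by rewrite ((pcharf0P F).1 F0). Qed.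

Lemma scalen_inj n : injective (fun u : L => n.+1%:R *: u).
Proof. exact: scalerI. Qed.

Lemma perpDl f g u : perp (f + g) u = perp f u + perp g u.
Proof. by have := perp_linl u 1 f g; rewrite !scale1r. Qed.

Lemma perp0l u : perp 0 u = 0.
Proof. by have := perp_linl u (-1) 0 0; rewrite !scaleN1r !addNr. Qed.

Lemma perpZl c f u : perp (c *: f) u = c *: perp f u.
Proof. by have := perp_linl u c f 0; rewrite !addr0 perp0l addr0. Qed.

Lemma perp_suml (I : Type) (r : seq I) (P : pred I) (f : I -> L) u :
  perp (\sum_(i <- r | P i) f i) u = \sum_(i <- r | P i) perp (f i) u.
Proof. by apply: (big_morph (perp ^~ u)) => [x y|]; [exact: perpDl|exact: perp0l]. Qed.

Lemma perpC f g u : perp f (perp g u) = perp g (perp f u).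
Proof. by rewrite -!perpM mulrC. Qed.

Lemma perp_pM i f g : perp (p i) (f * g) = perp (p i) f * g + f * perp (p i) g.
Proof.
move: f; apply: L_ind => [c f1 f2 H1 H2||j f H].
- rewrite mulrDl -scalerAl !perp_lin H1 H2 !mulrDl -!scalerAl scalerDr.
  by rewrite addrACA.
- by rewrite perp_p1 !mul1r mul0r add0r.
- by rewrite -mulrA !perp_pp H mulrDl -scalerAl mulrDr addrA !mulrA.
Qed.

(* The generating function of g is exp (\sum_i c_i p_(i+1) t^(i+1) / (i+1)). *)
Definition newton_seq (c : nat -> F) (g : nat -> L) := g 0 = 1 /\
  forall n, n.+1%:R *: g n.+1 = \sum_(i < n.+1) c i *: (p i * g (n - i)%N).

Lemma newton_seq_h : newton_seq (fun=> 1) h.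
Proof.
split=> // n; rewrite hS scalerA divff // scale1r.
by apply: eq_bigr => i _; rewrite expr1n.
Qed.

Lemma newton_seq_e : newton_seq (fun=> -1) (fun n => (-1) ^+ n *: e n).
Proof.
split=> [|n]; first by rewrite e0 scale1r.
rewrite eS 2!scalerA mulrAC mulfV // mul1r scaler_sumr; apply: eq_bigr => i _.
rewrite scalerA -scalerAr scalerA; congr (_ *: _).
have le : (i <= n)%N by rewrite -ltnS.
by rewrite -{1}(subnK le) exprS exprD -!mulrA -exprD addnn -mul2n exprM sqrrN !expr1n mulr1.
Qed.

Lemma newton_seq_scale t c g :
  newton_seq c g -> newton_seq (fun i => t ^+ i.+1 * c i) (fun n => t ^+ n *: g n).
Proof.
case=> g0 gS; split=> [|n]; first by rewrite g0 scale1r.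
rewrite scalerA mulrC -scalerA gS scaler_sumr; apply: eq_bigr => i _.
rewrite -scalerAr !scalerA; congr (_ *: _).
have le : (i <= n)%N by rewrite -ltnS.
by rewrite mulrAC -exprD addSn subnKC.
Qed.

(** Exponents add when generating functions are multiplied. The proof applies t d/dt to the product:
    n+1 is split as i + (n+1-i) and each part is rewritten by its own recursion. *)
Lemma newton_seq_conv c1 c2 g1 g2 : newton_seq c1 g1 -> newton_seq c2 g2 ->
  newton_seq (fun i => c1 i + c2 i) (fun n => \sum_(i < n.+1) g1 i * g2 (n - i)%N).
Proof.
case=> g10 g1S [g20 g2S]; split=> [|n].
  by rewrite big_ord_recl big_ord0 g10 g20 mulr1 addr0.
have -> : n.+1%:R *: \sum_(i < n.+2) g1 i * g2 (n.+1 - i)%N =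
  \sum_(i < n.+2) (i%:R *: g1 i) * g2 (n.+1 - i)%N
  + \sum_(i < n.+2) g1 i * ((n.+1 - i)%:R *: g2 (n.+1 - i)%N).
  rewrite scaler_sumr -big_split /=; apply: eq_bigr => i _.
  rewrite -scalerAl -scalerAr -scalerDl -natrD subnKC //.
  by rewrite -ltnS.
rewrite big_ord_recl scale0r mul0r add0r.
rewrite [X in _ + X]big_ord_recr /= subnn scale0r mulr0 addr0.
under eq_bigr => a _.
  rewrite /bump /= g1S subSS mulr_suml.
  under eq_bigr => i _ do rewrite -scalerAl.
  over.
rewrite (triangle_sum (fun i b k => c1 i *: (p i * g1 b * g2 k))).
have -> : \sum_(i < n.+1) g1 i * ((n.+1 - i)%:R *: g2 (n.+1 - i)%N) =
  \sum_(i < n.+1) \sum_(j < (n - i).+1) c2 j *: (p j * (g1 i * g2 (n - i - j)%N)).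
  apply: eq_bigr => i _; have le : (i <= n)%N by rewrite -ltnS.
  rewrite subSn // g2S mulr_sumr; apply: eq_bigr => j _.
  by rewrite -scalerAr mulrCA.
rewrite -(triangle_sum (fun i j k => c2 j *: (p j * (g1 i * g2 k)))).
have -> : \sum_(a < n.+1) \sum_(i < a.+1) c2 (a - i)%N *: (p (a - i)%N * (g1 i * g2 (n - a)%N)) =
  \sum_(a < n.+1) \sum_(i < a.+1) c2 i *: (p i * (g1 (a - i)%N * g2 (n - a)%N)).
  apply: eq_bigr => a _; rewrite (reindex_inj rev_ord_inj) /=; apply: eq_bigr => i _.
  by rewrite subSS subKn // -ltnS.
rewrite (triangle_sum (fun i b k => c2 i *: (p i * (g1 b * g2 k)))) -big_split /=.
apply: eq_bigr => i _; rewrite scalerDl mulr_sumr !scaler_sumr -!big_split /=.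
by apply: eq_bigr => b _; rewrite mulrA.
Qed.

Lemma perp_newtonS c g n u : newton_seq c g ->
  n.+1%:R *: perp (g n.+1) u = \sum_(i < n.+1) c i *: perp (p i) (perp (g (n - i)%N) u).
Proof.
case=> _ gS; rewrite -perpZl gS perp_suml; apply: eq_bigr => i _.
by rewrite perpZl perpM.
Qed.

(** Adjoints of power sums are derivations, so the adjoint of an exponential of power sums is
    multiplicative as a generating function. The argument is that of [newton_seq_conv]. *)
Lemma perp_newtonM c g n u v : newton_seq c g ->
  perp (g n) (u * v) = \sum_(i < n.+1) perp (g i) u * perp (g (n - i)%N) v.
Proof.
move=> gN; have g0 := gN.1; have gS := fun n u => perp_newtonS n u gN.
elim/ltn_ind: n => -[|n] IH.
  by rewrite big_ord_recl big_ord0 g0 !perp1 addr0.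
apply: (@scalen_inj n); rewrite /= gS.
have -> : n.+1%:R *: \sum_(i < n.+2) perp (g i) u * perp (g (n.+1 - i)%N) v =
  \sum_(i < n.+2) (i%:R *: perp (g i) u) * perp (g (n.+1 - i)%N) v
  + \sum_(i < n.+2) perp (g i) u * ((n.+1 - i)%:R *: perp (g (n.+1 - i)%N) v).
  rewrite scaler_sumr -big_split /=; apply: eq_bigr => i _.
  rewrite -scalerAl -scalerAr -scalerDl -natrD subnKC //.
  by rewrite -ltnS.
rewrite [X in _ = X + _]big_ord_recl scale0r mul0r add0r.
rewrite [X in _ = _ + X]big_ord_recr /= subnn scale0r mulr0 addr0.
under [X in _ = X + _]eq_bigr => a _.
  rewrite /bump /= gS subSS mulr_suml.
  under eq_bigr => i _ do rewrite -scalerAl.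
  over.
rewrite (triangle_sum (fun i b k => c i *: (perp (p i) (perp (g b) u) * perp (g k) v))).
have -> : \sum_(i < n.+1) perp (g i) u * ((n.+1 - i)%:R *: perp (g (n.+1 - i)%N) v) =
  \sum_(i < n.+1) \sum_(j < (n - i).+1)
    c j *: (perp (g i) u * perp (p j) (perp (g (n - i - j)%N) v)).
  apply: eq_bigr => i _; have le : (i <= n)%N by rewrite -ltnS.
  by rewrite subSn // gS mulr_sumr; apply: eq_bigr => j _; rewrite -scalerAr.
rewrite -(triangle_sum (fun i j k => c j *: (perp (g i) u * perp (p j) (perp (g k) v)))).
have -> : \sum_(a < n.+1) \sum_(i < a.+1)
    c (a - i)%N *: (perp (g i) u * perp (p (a - i)%N) (perp (g (n - a)%N) v)) =
  \sum_(a < n.+1) \sum_(i < a.+1)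
    c i *: (perp (g (a - i)%N) u * perp (p i) (perp (g (n - a)%N) v)).
  apply: eq_bigr => a _; rewrite (reindex_inj rev_ord_inj) /=; apply: eq_bigr => i _.
  by rewrite subSS subKn // -ltnS.
rewrite (triangle_sum (fun i b k => c i *: (perp (g b) u * perp (p i) (perp (g k) v)))).
rewrite -big_split /=; apply: eq_bigr => i _.
rewrite IH ?ltnS ?leq_subr // linear_sum scaler_sumr -big_split /=; apply: eq_bigr => b _.
by rewrite perp_pM scalerDr.
Qed.

(** Induction through Newton's recursion: differentiating the explicit power sum gives i+1 copies of
    h_(n-i), the induction hypothesis gives n-i more, in total n+1. *)
Lemma perp_p_h i n : perp (p i) (h n) = if (i < n)%N then h (n - i.+1)%N else 0.
Proof.
have [_ hN] := newton_seq_h.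
elim/ltn_ind: n => -[|n] IH; first by rewrite h0 perp_p1.
apply: (@scalen_inj n); rewrite /= -linearZ hN linear_sum /=.
under eq_bigr => j _.
  rewrite scale1r perp_pp IH; last by rewrite ltnS leq_subr.
  over.
rewrite big_split /= subSS ltnS; case: leqP => [le|lt]; last first.
  rewrite scaler0 big1 ?add0r => [|j _]; last first.
    case: (i =P j :> nat) => [ij|_]; last exact: scale0r.
    by rewrite ij ltnNge -ltnS ltn_ord in lt.
  by rewrite big1 // => j _; rewrite ltnNge (leq_trans (leq_subr _ _) (ltnW lt)) mulr0.
have -> : \sum_(j < n.+1) ((i == j) * i.+1)%:R *: h (n - j) = i.+1%:R *: h (n - i).
  have lt : (i < n.+1)%N by [].
  rewrite (bigD1 (Ordinal lt)) //= eqxx mul1n big1 ?addr0 // => j.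
  rewrite -val_eqE /= eq_sym => /negbTE ->; exact: scale0r.
have -> : \sum_(j < n.+1) p j * (if (i < n - j)%N then h (n - j - i.+1) else 0) =
   (n - i)%:R *: h (n - i).
  rewrite (@sum_ord_stable _ (fun j => p j * (if (i < n - j)%N then h (n - j - i.+1) else 0)) _ (n - i)).
  - case ni : (n - i)%N => [|k]; first by rewrite big_ord0 scale0r.
    rewrite hN; apply: eq_bigr => j _; have jk := ltn_ord j; rewrite scale1r.
    by rewrite ifT; [congr (_ * h _); lia|lia].
  - by move=> j nj; rewrite ifF ?mulr0 //; lia.
  - by move=> j nj; rewrite ifF ?mulr0 //; lia.
by rewrite -scalerDl -natrD; congr (_%:R *: _); lia.
Qed.

Lemma perp_p_zext i a : perp (p i) (zext a) = zext (a - i.+1%:Z).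
Proof.
case: a => n; last first.
  by rewrite /= linear0; case E: (Negz n - i.+1%:Z) => [k|k] //; lia.
rewrite /= perp_p_h; case: ltnP => [lt|le].
  by have -> : n%:Z - i.+1%:Z = (n - i.+1)%N%:Z by lia.
by case E: (n%:Z - i.+1%:Z) => [k|k] //; lia.
Qed.

(** As every adjoint of a power sum shifts the index of h, [g k] acts by the shift by [k] times the
    value [s k] of [g k] at all power sums equal to 1. *)
Lemma perp_newton_zext c g (s : nat -> F) k a : newton_seq c g -> s 0 = 1 ->
  (forall n, n.+1%:R * s n.+1 = \sum_(i < n.+1) c i * s (n - i)%N) ->
  perp (g k) (zext a) = s k *: zext (a - k%:Z).
Proof.
move=> gN s0 sS; elim/ltn_ind: k a => -[|k] IH a.
  by rewrite gN.1 perp1 s0 scale1r subr0.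
apply: (@scalen_inj k); rewrite /= (perp_newtonS _ _ gN) scalerA sS scaler_suml.
apply: eq_bigr => i _; have le : (i <= k)%N by rewrite -ltnS.
rewrite IH ?ltnS ?leq_subr // linearZ /= perp_p_zext scalerA.
by congr (_ *: zext _); lia.
Qed.

(** The coefficient of t^n in H(q t) / H(t) = exp (sum_i (q^i - 1) p_i t^i / i), where H is the
    generating function of the h_r. *)
Definition vseq n : L := \sum_(i < n.+1) ((-1) ^+ i *: e i) * (q ^+ (n - i) *: h (n - i)).

Definition theta k (f : L) : L := perp (vseq k) f.

Lemma newton_seq_vseq : newton_seq (fun i => -1 + q ^+ i.+1 * 1) vseq.
Proof.
exact: (newton_seq_conv newton_seq_e (newton_seq_scale q newton_seq_h)).
Qed.

HB.instance Definition _ k := GRing.isLinear.Build F L L *:%R (theta k) (perp_lin (vseq k)).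

Lemma theta0 f : theta 0 f = f.
Proof. by rewrite /theta newton_seq_vseq.1 perp1. Qed.

Lemma thetaM k f g : theta k (f * g) = \sum_(i < k.+1) theta i f * theta (k - i) g.
Proof. exact: (perp_newtonM _ _ _ newton_seq_vseq). Qed.

Lemma thetaC i j f : theta i (theta j f) = theta j (theta i f).
Proof. exact: perpC. Qed.

Lemma theta_zext k a : theta k (zext a) = h_coef q k *: zext (a - k%:Z).
Proof.
apply: (perp_newton_zext _ _ newton_seq_vseq) => // n.
(* Newton's recursion for [h_coef]: each term with i < m is [h_coef q m.+1] minus
   [h_coef q (m - i)], and the subtracted values telescope. *)
have tele : forall m, \sum_(i < m) (-1 + q ^+ i.+1 * 1) * h_coef q (m - i) + (-1 + q ^+ m.+1) =
    m.+1%:R * h_coef q m.+1.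
  move=> m; have -> : \sum_(i < m) (-1 + q ^+ i.+1 * 1) * h_coef q (m - i) =
     \sum_(i < m) (h_coef q m.+1 - h_coef q (m - i)).
    apply: eq_bigr => i _; rewrite mulr1 mulrDl mulN1r addrC; congr (_ - _).
    have im := ltn_ord i; rewrite -(subnSK im) /h_coef mulrBr -!exprD.
    by congr (q ^+ _ - q ^+ _); lia.
  rewrite sumrB sumr_const card_ord (reindex_inj rev_ord_inj) /=.
  have -> : \sum_(j < m) h_coef q (m - (m - j.+1)) = q ^+ m - 1.
    rewrite -[X in _ = _ - X](expr0 q) -telescope_sumr // big_mkord.
    by apply: eq_bigr => j _; rewrite subKn.
  by rewrite -mulr_natl -[m.+1%:R]natr1 /h_coef; ring.
by rewrite -tele big_ord_recr subnn !mulr1.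
Qed.

Lemma theta_eq0 k f : (deg f < k)%N -> theta k f = 0.
Proof.
move=> lt; rewrite /theta /vseq perp_suml big1 // => i _.
rewrite -scalerAl -scalerAr scalerA perpZl perp_eh0 ?scaler0 // subnKC //.
by rewrite -ltnS.
Qed.

(** The double sum defining B_a is regrouped by k = j + r. Any bound beyond which theta_k f vanishes
    may be used, so several functions can share one. *)
Lemma BE a f K : (forall k, (K <= k)%N -> theta k f = 0) ->
  B a f = \sum_(k < K) zext (a + k%:Z) * theta k f.
Proof.
move=> thK.
rewrite (@sum_ord_stable _ (fun k => zext (a + k%:Z) * theta k f) K (deg f).+1); last first.
- by move=> k fk; rewrite theta_eq0 ?mulr0.
- by move=> k /thK ->; rewrite mulr0.
rewrite Bdef; set n := deg f.
pose G j r := zext (a + j%:Z + r%:Z) * ((-1) ^+ r * q ^+ j *: perp (e r * h j) f).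
transitivity (\sum_(j < n.+1) \sum_(r < (n - j).+1) G j r).
  apply: eq_bigr => j _; rewrite scaler_sumr.
  under eq_bigr => r _.
    rewrite scalerA -perpM scalerAr [q ^+ j * _]mulrC; over.
  rewrite (@sum_ord_stable _ (G j) _ (n - j).+1) // => r lt; rewrite /G.
    have -> : perp (e r * h j) f = 0; last by rewrite scaler0 mulr0.
    by rewrite perpM -(mulr1 (e r)) -h0 perp_eh0 // addn0.
  rewrite perp_eh0 ?scaler0 ?mulr0 // -/n.
  have := ltn_ord j; lia.
rewrite -(triangle_sum (fun j r _ => G j r)); apply: eq_bigr => k _.
rewrite /theta /vseq perp_suml mulr_sumr (reindex_inj rev_ord_inj) /=.
apply: eq_bigr => i _; have ik : (i <= k)%N by rewrite -ltnS.
rewrite subSS subKn // -scalerAl -[e i * _]scalerAr scalerA perpZl /G.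
by congr (zext _ * _); lia.
Qed.

End SymmetricFunctionOperators.

(** * Formal linear combinations *)

Section LinearSum.
Context (F : fieldType) (K : choiceType).

Definition lsum (V : lmodType F) (c : {malg F[K]}) (X : K -> V) : V :=
  \sum_(k <- monalg.msupp c) monalg.mcoeff k c *: X k.

Lemma lsumEw (V : lmodType F) (c : {malg F[K]}) (X : K -> V) (d : {fset K}) :
  (monalg.msupp c `<=` d)%fset -> lsum c X = \sum_(k <- d) monalg.mcoeff k c *: X k.
Proof.
move=> le; rewrite /lsum (big_fset_incl _ le) // => k _ kc.
by rewrite monalg.mcoeff_outdom ?scale0r.
Qed.

Lemma lsumD (V : lmodType F) (c1 c2 : {malg F[K]}) (X : K -> V) :
  lsum (c1 + c2) X = lsum c1 X + lsum c2 X.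
Proof.
rewrite (lsumEw _ (monalg.msuppD_le c1 c2)) (lsumEw _ (fsubsetUl _ (monalg.msupp c2))).
rewrite (lsumEw _ (fsubsetUr (monalg.msupp c1) _)) -big_split /=.
by apply: eq_bigr => k _; rewrite monalg.mcoeffD scalerDl.
Qed.

Lemma lsumU (V : lmodType F) (x : F) (k : K) (X : K -> V) : lsum << x *g k >> X = x *: X k.
Proof. by rewrite (lsumEw _ monalg.msuppU_le) big_seq_fset1 monalg.mcoeffUU. Qed.

End LinearSum.

Lemma subr_moveR (V : zmodType) (x y z : V) : x - y = z -> x = z + y.
Proof. by move=> <-; rewrite subrK. Qed.

(** * The recursive and the subset form of elementary symmetric polynomials *)

Section Elem.
Context (S : idomainType) (N : nat) (x : 'I_N -> S).

Lemma elemS k t (tN : (t < N)%N) :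
  elem x k.+1 t.+1 = elem x k.+1 t + x (Ordinal tN) * elem x k t.
Proof.
rewrite /= (bigD1 (Ordinal tN)) //= addrC; congr (_ + _).
apply: eq_bigl => r; rewrite -val_eqE /= ltnS; lia.
Qed.

Lemma sum_subsets_elem k t : (t <= N)%N ->
  \sum_(A : {set 'I_N} | (#|A| == k) && (A \subset [set i : 'I_N | (i < t)%N])) \prod_(i in A) x i
  = elem x k t.
Proof.
elim: t k => [|t IH] [|k] tN.
- rewrite (big_pred1 set0) ?big_set0 // => A; rewrite cards_eq0.
  by rewrite /=; case: (A =P set0) => [->|//]; rewrite sub0set.
- rewrite /= [RHS]big1 // big1 // => A /andP[/eqP cA /subsetP sA].
  have /card_gt0P[i /sA] : (0 < #|A|)%N by rewrite cA.
  by rewrite inE.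
- rewrite (big_pred1 set0) ?big_set0 // => A; rewrite cards_eq0.
  by rewrite /=; case: (A =P set0) => [->|//]; rewrite sub0set.
set o := Ordinal tN; rewrite (elemS _ tN) -/o -!IH 1?ltnW //.
rewrite (bigID (fun A : {set 'I_N} => o \in A)) /= addrC; congr (_ + _).
  apply: eq_bigl => A; rewrite -andbA; congr (_ && _).
  apply/andP/subsetP => [[/subsetP sA oA] i iA|sA].
    have := sA i iA; rewrite !inE ltnS leq_eqVlt => /predU1P[it|//].
    by case/negP: oA; rewrite (_ : o = i) //; apply: val_inj.
  split; last by apply/negP => /sA; rewrite inE ltnn.
  by apply/subsetP => i /sA; rewrite !inE => /ltnW.
rewrite (reindex_onto (fun A => o |: A) (fun A => A :\ o)) /=; last first.
  by move=> A /andP[_ oA]; rewrite setD1K.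
rewrite mulr_sumr; apply: eq_big => [A|A /andP[_ /eqP AE]]; last first.
  by rewrite big_setU1 // -AE setD11.
rewrite setU11 andbT; case oA: (o \in A).
  rewrite (_ : _ == A = false) ?andbF; last first.
    by apply/negbTE/negP => /eqP AE; move: oA; rewrite -AE setD11.
  apply/esym/negbTE/negP => /andP[_ /subsetP/(_ o oA)].
  by rewrite inE ltnn.
rewrite setU1K ?oA // eqxx andbT cardsU1 oA add1n eqSS; congr (_ && _).
apply/subsetP/subsetP => sA i iA.
  have := sA i; rewrite !inE iA orbT => /(_ isT); rewrite ltnS leq_eqVlt => /predU1P[it|//].
  by move: oA; rewrite (_ : o = i) ?iA //; apply: val_inj.
move: iA; rewrite !inE => /predU1P[->//|/sA].
by rewrite inE => /ltnW.
Qed.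
End Elem.

Lemma mesym_elem (F : fieldType) N k : mesym N F k = elem (fun i => mpolyX F U_(i)) k N.
Proof.
rewrite -sum_subsets_elem //; apply: eq_bigl => A.
by rewrite (_ : A \subset _) ?andbT //; apply/subsetP => i _; rewrite inE.
Qed.

(** * Commutation relations of the operators B_a and their products on 1 *)

Section VertexOperators.
Context (F : fieldType) (L : comAlgType F) (q : F).
Context (H : int -> L) (theta : nat -> L -> L) (B : int -> L -> L).
Hypotheses (H0 : H 0 = 1) (Hneg : forall n, H (Negz n) = 0)
  (theta_lin : forall k, linear (theta k))
  (theta0 : forall f, theta 0 f = f)
  (thetaM : forall k f g, theta k (f * g) = \sum_(i < k.+1) theta i f * theta (k - i) g)
  (thetaC : forall i j f, theta i (theta j f) = theta j (theta i f))
  (theta_H : forall k a, theta k (H a) = h_coef q k *: H (a - k%:Z))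
  (theta_nil : forall f, exists K, forall k, (K <= k)%N -> theta k f = 0)
  (BE : forall a f K, (forall k, (K <= k)%N -> theta k f = 0) ->
    B a f = \sum_(k < K) H (a + k%:Z) * theta k f).

HB.instance Definition _ k := GRing.isLinear.Build F L L *:%R (theta k) (theta_lin k).

Lemma theta_nil2 f g : exists K, forall k, (K <= k)%N -> theta k f = 0 /\ theta k g = 0.
Proof.
have [K1 H1] := theta_nil f; have [K2 H2] := theta_nil g.
by exists (maxn K1 K2) => k; rewrite geq_max => /andP[/H1 -> /H2 ->].
Qed.

Lemma theta1 k : theta k.+1 1 = 0.
Proof. by rewrite -H0 theta_H sub0r -NegzE Hneg scaler0. Qed.

Lemma B_lin a : linear (B a).
Proof.
move=> c f g; have [K HK] := theta_nil2 f g.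
rewrite !(@BE a _ K) => [|k /HK[//]|k /HK[//]|k /HK[Hf Hg]];
  last by rewrite theta_lin Hf Hg scaler0 addr0.
rewrite scaler_sumr -big_split /=; apply: eq_bigr => k _.
by rewrite theta_lin mulrDr scalerAr.
Qed.

HB.instance Definition _ a := GRing.isLinear.Build F L L *:%R (B a) (B_lin a).

Lemma B_scale a c f : B a (c *: f) = c *: B a f.
Proof. exact: linearZ. Qed.

Lemma B_sub a f g : B a (f - g) = B a f - B a g.
Proof. exact: linearB. Qed.

Lemma thetaZ k c f : theta k (c *: f) = c *: theta k f.
Proof. exact: linearZ. Qed.

Lemma B_one a : B a 1 = H a.
Proof.
rewrite (@BE _ _ 1) ?big_ord1 ?theta0 ?mulr1 ?addr0 // => -[|k] // _.
exact: theta1.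
Qed.

Lemma theta_theta_nil f K : (forall k, (K <= k)%N -> theta k f = 0) ->
  forall i k, (K <= k)%N -> theta k (theta i f) = 0.
Proof. by move=> HK i k /HK E; rewrite thetaC E linear0. Qed.

Lemma theta_B r a f :
  theta r (B a f) = \sum_(i < r.+1) h_coef q i *: B (a - i%:Z) (theta (r - i) f).
Proof.
have [K HK] := theta_nil f; rewrite (BE a HK) linear_sum /=.
under eq_bigr => k _ do rewrite thetaM.
rewrite exchange_big /=; apply: eq_bigr => i _.
rewrite (BE _ (theta_theta_nil HK _)) scaler_sumr; apply: eq_bigr => k _.
by rewrite theta_H thetaC -scalerAl; congr (_ *: (H _ * _)); lia.
Qed.

(** Multiplying the series (1 - t) / (1 - q t) by 1 - q t leaves 1 - t, so only two terms of
    [theta_B] survive. *)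
Lemma theta_B_shift k b f : theta k.+1 (B b f) - q *: theta k (B (b - 1) f) =
  B b (theta k.+1 f) - B (b - 1) (theta k f).
Proof.
rewrite !theta_B big_ord_recl scale1r subn0 subr0 -addrA; congr (_ + _).
rewrite scaler_sumr -sumrB big_ord_recl big1 => [|[i ik] _] /=.
  rewrite /bump /= subSS !subn0 !subr0 scale1r addn0 expr0 expr1 addr0 scalerBl scale1r.
  by rewrite addrAC subrr add0r.
rewrite /bump /= !add1n scalerA subSS.
have -> : b - i.+2%:Z = b - 1 - i.+1%:Z by lia.
rewrite -scalerBl mulrBr -!exprS subrr scale0r.
by [].
Qed.

Lemma BB_expand a b f K : (forall k, (K <= k)%N ->
    [/\ theta k f = 0, theta k (B b f) = 0 & theta k (B (b - 1) f) = 0]) ->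
  B a (B b f) - q *: B (a + 1) (B (b - 1) f) =
  \sum_(s < K.+1) \sum_(l < K.+1)
    (H (a + s%:Z) * H (b + l%:Z) - H (a + 1 + s%:Z) * H (b - 1 + l%:Z))
      * theta s (theta l f).
Proof.
move=> HK.
have K0 k : (K < k.+1)%N -> theta k f = 0 by move=> /HK[].
have K1 k : (K.+1 <= k)%N -> theta k (B b f) = 0 by move=> /ltnW /HK[].
have K2 k : (K <= k)%N -> theta k (B (b - 1) f) = 0 by move=> /HK[].
rewrite (BE _ K1) (BE _ K2) big_ord_recl theta0 scaler_sumr -addrA -sumrB.
under eq_bigr => k _.
  have -> : a + (lift ord0 k : nat)%:Z = a + 1 + k%:Z by rewrite /= /bump; lia.
  rewrite scalerAr -mulrBr theta_B_shift mulrBr; over.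
rewrite sumrB addrA.
have K0' k : (K.+1 <= k)%N -> theta k f = 0 by move=> /ltnW /K0.
have -> : H (a + 0) * B b f + \sum_(k < K) H (a + 1 + k%:Z) * B b (theta k.+1 f) =
   \sum_(s < K.+1) H (a + s%:Z) * B b (theta s f).
  rewrite big_ord_recl theta0; congr (_ + _); apply: eq_bigr => k _.
  by congr (H _ * _); rewrite /= /bump; lia.
have -> : \sum_(k < K) H (a + 1 + k%:Z) * B (b - 1) (theta k f) =
   \sum_(s < K.+1) H (a + 1 + s%:Z) * B (b - 1) (theta s f).
  by rewrite [RHS]big_ord_recr /= K0 // linear0 mulr0 addr0.
rewrite -sumrB; apply: eq_bigr => s _.
rewrite !(BE _ (theta_theta_nil K0' s)) !mulr_sumr -sumrB; apply: eq_bigr => l _.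
by rewrite !mulrA -mulrBl thetaC.
Qed.

Lemma theta_nil_seq (fs : seq L) : exists K, forall k, (K <= k)%N -> forall f, f \in fs -> theta k f = 0.
Proof.
elim: fs => [|f fs [K HK]]; first by exists 0.
have [K' HK'] := theta_nil f; exists (maxn K K') => k; rewrite geq_max => /andP[/HK H1 /HK' H2] g.
by rewrite in_cons => /predU1P[->|/H1].
Qed.

(** In [BB_expand] the coefficient changes sign when (a, b) becomes (b - 1, a + 1) and the two
    summation indices are exchanged, while theta_s theta_l is symmetric. *)
Lemma BB_comm a b f : B a (B b f) - q *: B (a + 1) (B (b - 1) f) =
  - (B (b - 1) (B (a + 1) f) - q *: B b (B a f)).
Proof.
have [K HK] := theta_nil_seq [:: f; B b f; B (b - 1) f; B (a + 1) f; B a f].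
rewrite (@BB_expand a b f K) => [|k /HK E]; last by split; apply: E; rewrite !inE eqxx ?orbT.
have := @BB_expand (b - 1) (a + 1) f K; rewrite addrK subrK => -> => [|k /HK E]; last first.
  by split; apply: E; rewrite !inE eqxx ?orbT.
rewrite exchange_big -sumrN; apply: eq_bigr => s _; rewrite -sumrN; apply: eq_bigr => l _.
rewrite -[RHS]mulNr opprB thetaC; congr (_ * _).
by rewrite [H (b - 1 + _) * _]mulrC [H (b + _) * _]mulrC.
Qed.

Hypothesis F0 : [pchar F] =i pred0.

Lemma antisym_eq0 (u : L) : u = - u -> u = 0.
Proof.
move=> /eqP; rewrite -subr_eq0 opprK -mulr2n -scaler_nat scaler_eq0.
by rewrite ((pcharf0P F).1 F0) => /eqP.
Qed.

(** When b = a + 1 the substitution of [BB_comm] fixes (a, b), so the expression equals its own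
    negative. *)
Lemma B1_B2 f : B 1 (B 2 f) = q *: B 2 (B 1 f).
Proof. by apply/eqP; rewrite -subr_eq0; apply/eqP/antisym_eq0/(BB_comm 1 2). Qed.

Lemma B0_B1 f : B 0 (B 1 f) = q *: B 1 (B 0 f).
Proof. by apply/eqP; rewrite -subr_eq0; apply/eqP/antisym_eq0/(BB_comm 0 1). Qed.

Lemma B0_B2 f : B 0 (B 2 f) = q *: B 2 (B 0 f) - (1 - q) *: B 1 (B 1 f).
Proof.
have E := BB_comm 0 2 f; rewrite opprB in E.
have {E} : B 0 (B 2 f) - q *: B 1 (B 1 f) = q *: B 2 (B 0 f) - B 1 (B 1 f) := E.
move=> /subr_moveR ->.
by rewrite scalerBl scale1r opprB addrA addrAC.
Qed.

Definition B1pow n : L := iter n (B 1) 1.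

Arguments B1pow : simpl never.

Lemma B1powS n : B1pow n.+1 = B 1 (B1pow n).
Proof. by []. Qed.

Lemma B0_K n : B 0 (B1pow n) = q ^+ n *: B1pow n.
Proof.
elim: n => [|n IH]; first by rewrite B_one H0 scale1r.
by rewrite B1powS B0_B1 IH B_scale scalerA -exprS.
Qed.

Lemma B1pow_coefS n k : B1pow_coef q n k.+1 = - (1 - q ^+ (n - k)) * B1pow_coef q n k.
Proof. by rewrite /B1pow_coef exprS big_ord_recr /=; ring. Qed.

Lemma B1pow_coef_eq0 n k : (n < k)%N -> B1pow_coef q n k = 0.
Proof.
move=> nk; rewrite /B1pow_coef (bigD1 (Ordinal nk)) //= subnn expr0 subrr mul0r mulr0.
by [].
Qed.

(** [theta_B_shift] at b = 1, where B_0 acts on B_1^n 1 by the eigenvalue q^n. *)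
Lemma theta_K n k : theta k (B1pow n) = B1pow_coef q n k *: B1pow (n - k).
Proof.
elim: n k => [|n IH] [|k]; rewrite ?theta0 ?subn0.
- by rewrite /B1pow_coef big_ord0 mulr1 scale1r.
- by rewrite theta1 B1pow_coef_eq0 // scale0r.
- by rewrite /B1pow_coef big_ord0 mulr1 scale1r.
have := theta_B_shift k 1 (B1pow n).
rewrite [1 - 1]/= B0_K thetaZ !IH !B_scale B0_K.
move=> /subr_moveR ->; rewrite subSS.
(* For n <= k the truncated index no longer drops by one, but then the coefficient vanishes. *)
have -> : B1pow_coef q n k.+1 *: B 1 (B1pow (n - k.+1)) = B1pow_coef q n k.+1 *: B1pow (n - k).
  case: (leqP n k) => nk; first by rewrite !B1pow_coef_eq0 // !scale0r.
  by rewrite -(subnSK nk).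
rewrite !scalerA -scalerBl -scalerDl B1pow_coefS B1pow_coef_SS exprS.
by congr (_ *: _); ring.
Qed.

Lemma K_nil n k : (n < k)%N -> theta k (B1pow n) = 0.
Proof. by move=> nk; rewrite theta_K B1pow_coef_eq0 // scale0r. Qed.

Lemma K_rec n :
  B1pow n.+1 = \sum_(k < n.+1) B1pow_coef q n k *: (H (1 + k%:Z) * B1pow (n - k)).
Proof.
rewrite B1powS (BE _ (@K_nil n)); apply: eq_bigr => k _.
by rewrite theta_K scalerAr.
Qed.

(** Both sides are expanded over h_(1+k). Since theta_(i+1) B_1^(n+1) 1 is -(1 - q^(n+1)) theta_i
    B_1^n 1, everything cancels except the term in which theta acts on [f] alone. *)
Lemma K_mulB1 n f : B1pow n.+1 * B 1 f =
  B 1 (B1pow n.+1 * f) + (1 - q ^+ n.+1) *: B 2 (B1pow n * f).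
Proof.
have [K HK] := theta_nil_seq [:: f; B1pow n.+1 * f; B1pow n * f].
have K0 k : (K.+1 <= k)%N -> theta k f = 0.
  by move=> /ltnW /HK; apply; rewrite !inE eqxx.
have K1 k : (K.+1 <= k)%N -> theta k (B1pow n.+1 * f) = 0.
  by move=> /ltnW /HK; apply; rewrite !inE eqxx orbT.
have K2 k : (K <= k)%N -> theta k (B1pow n * f) = 0.
  by move=> /HK; apply; rewrite !inE eqxx !orbT.
rewrite (BE _ K0) (BE _ K1) (BE _ K2) !big_ord_recl !theta0 mulrDr -addrA.
congr (_ + _); first by rewrite mulrCA.
rewrite scaler_sumr -big_split mulr_sumr; apply: eq_bigr => k _ /=.
rewrite mulrCA; have -> : 2 + k%:Z = 1 + (bump 0 k)%:Z by rewrite /bump; lia.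
rewrite scalerAr -mulrDr; congr (_ * _); rewrite /bump /= add1n !thetaM.
rewrite big_ord_recl theta0 subn0 -addrA -[LHS]addr0; congr (_ + _).
rewrite scaler_sumr -big_split big1 // => i _ /=.
rewrite /bump /= !add1n subSS !theta_K B1pow_coef_SS subSS -!scalerAl scalerA -scalerDl.
by rewrite mulNr addNr scale0r.
Qed.

Lemma K_mulK a b : B1pow a.+1 * B1pow b.+1 =
  B 1 (B1pow a.+1 * B1pow b) + (1 - q ^+ a.+1) *: B 2 (B1pow a * B1pow b).
Proof. exact: K_mulB1. Qed.

(* B_11^h B_1^j 1, with B_11 = B_1 B_1 - q B_2 B_0 and B_0 replaced by its
   eigenvalue q^(h+j). *)
Fixpoint B11pow h j : L := if h is h'.+1 then
  B 1 (B 1 (B11pow h' j)) - q ^+ (1 + h' + j) *: B 2 (B11pow h' j) else B1pow j.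

Lemma B11powS h j : B11pow h.+1 j =
  B 1 (B 1 (B11pow h j)) - q ^+ (1 + h + j) *: B 2 (B11pow h j).
Proof. by []. Qed.

Arguments B11pow : simpl never.

(** The factor q from B_1 B_2 = q B_2 B_1 is the change of q^(1+h+j) when j grows by one. *)
Lemma B1_D h j : B 1 (B11pow h j) = B11pow h j.+1.
Proof.
elim: h => [|h IH] //; rewrite !B11powS B_sub B_scale B1_B2 -IH scalerA -exprSr.
by rewrite addnS.
Qed.

Lemma D_S h j : B11pow h.+1 j = B11pow h j.+2 - q ^+ (1 + h + j) *: B 2 (B11pow h j).
Proof. by rewrite B11powS !B1_D. Qed.

(** The eigenvalue that justifies the form of [B11pow]. Two commutations with B_1 give q^2, and the
    B_1 B_1 term of [B0_B2] lowers this to q. *)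
Lemma B0_D h j : B 0 (B11pow h j) = q ^+ (h + j) *: B11pow h j.
Proof.
elim: h => [|h IH]; first exact: B0_K.
rewrite B11powS B_sub B_scale !B0_B1 B0_B2 IH !B_scale.
rewrite !scalerBr !scalerA opprB addrCA addrA -scalerDl addrC.
rewrite [- _ + _]addrC; congr (_ *: _ - _ *: _); rewrite ?exprD ?exprS; ring.
Qed.

Lemma B11_D h j : B 1 (B 1 (B11pow h j)) - q *: B 2 (B 0 (B11pow h j)) = B11pow h.+1 j.
Proof. by rewrite B0_D B_scale scalerA -exprS. Qed.

Lemma B1_D1 h : B 1 (B11pow h 1) = B11pow h.+1 0 + q ^+ h.+1 *: B 2 (B11pow h 0).
Proof. by rewrite B1_D D_S addn0 add1n subrK. Qed.

(** * Evaluation in N variables and comparison with domino words *)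

Section Evaluation.
Context (N : nat) (ev : L -> mpoly.mpoly N F).
Hypotheses (ev_lin : linear ev) (ev1 : ev 1 = 1)
  (evM : forall f g, ev (f * g) = ev f * ev g)
  (ev_H : forall r : nat, ev (H r%:Z) = mesym N F r)
  (q_neq0 : q != 0) (q_gen : forall n, 1 - q ^+ n.+1 != 0).
Local Notation S := (mpoly.mpoly N F).
Local Notation emb := (@mpoly.mpolyC N F).
Local Notation qS := (emb q).
Local Notation X := (fun i : 'I_N => mpolyX F U_(i)).

HB.instance Definition _ := GRing.isLinear.Build F L S *:%R ev ev_lin.

Lemma evZ c f : ev (c *: f) = emb c * ev f.
Proof. by rewrite linearZ /= -mul_mpolyC. Qed.

Lemma evD f g : ev (f + g) = ev f + ev g.
Proof. exact: linearD. Qed.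

Lemma B1pow_coef_morph n k : emb (B1pow_coef q n k) = B1pow_coef qS n k.
Proof.
rewrite /B1pow_coef rmorphM rmorphXn rmorphN1 rmorph_prod; congr (_ * _).
by apply: eq_bigr => i _; rewrite rmorphB rmorph1 rmorphXn.
Qed.

Lemma qS_neq0 : qS != 0.
Proof. by rewrite mpolyC_eq0. Qed.

Lemma qS_gen n : 1 - qS ^+ n.+1 != 0.
Proof. by rewrite -rmorphXn -(rmorph1 (emb)) -rmorphB mpolyC_eq0. Qed.

Lemma two_S : 2%:R != 0 :> S.
Proof. by rewrite -(rmorph_nat (emb)) mpolyC_eq0 ((pcharf0P F).1 F0). Qed.

Lemma ev_K n : ev (B1pow n) = clique_sum qS n X.
Proof.
elim/ltn_ind: n => -[|n] IH; first exact: ev1.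
rewrite K_rec linear_sum clique_sum_rec; last exact: two_S.
apply: eq_bigr => k _ /=.
rewrite evZ evM B1pow_coef_morph -PoszD add1n ev_H mesym_elem mulrA IH //.
by rewrite ltnS leq_subr.
Qed.

(** The family playing the role of [G] in the identification: cliques become factors B_1^a 1 and
    B_1^b 1, whose product is symmetric. *)
Definition ev_B l j a b : S := ev (iter l (B 2) (iter j (B 1) (B1pow a * B1pow b))).

Lemma iterB_lin a n : linear (iter n (B a)).
Proof. by elim: n => [|n IH] c f g //=; rewrite IH B_lin. Qed.

Lemma iterBZ a n c f : iter n (B a) (c *: f) = c *: iter n (B a) f.
Proof. by elim: n => [|n IH] //=; rewrite IH B_scale. Qed.

Lemma iterBD a n f g : iter n (B a) (f + g) = iter n (B a) f + iter n (B a) g.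
Proof. by have := iterB_lin a n 1 f g; rewrite !scale1r. Qed.

Lemma iterB1_B2 j f : iter j (B 1) (B 2 f) = q ^+ j *: B 2 (iter j (B 1) f).
Proof.
elim: j => [|j IH]; first by rewrite scale1r.
by rewrite !iterS IH B_scale B1_B2 scalerA exprSr.
Qed.

Lemma ev_B_col l j a b : ev_B l j a.+1 b.+1 - ev_B l j.+1 a.+1 b =
  (1 - qS ^+ a.+1) * qS ^+ j * ev_B l.+1 j a b.
Proof.
rewrite /ev_B K_mulK !iterBD -iterSr iterBZ iterB1_B2 !iterBZ -iterSr evD addrAC subrr add0r.
by rewrite !evZ rmorphB rmorph1 !rmorphXn mulrA.
Qed.

Lemma ev_domino_eval l h j : domino_eval qS X l h j =
  qS ^+ (l * h + 'C(l, 2)) * ev (iter l (B 2) (B11pow h j)).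
Proof.
apply: (domino_eval_D two_S qS_neq0 qS_gen (G := ev_B) _ _ _ _
  (D := fun l h j => ev (iter l (B 2) (B11pow h j)))).
- by move=> a b; rewrite /ev_B evM !ev_K.
- exact: ev_B_col.
- by move=> l' j' a b; rewrite /ev_B mulrC.
- by move=> l' j' b; rewrite /ev_B /B1pow /= !mul1r -iterSr.
- by move=> l' j'; rewrite /ev_B mulr1.
move=> l' h' j'; rewrite D_S iterBD evD -scaleNr iterBZ -iterSr /= !evZ.
by rewrite rmorphN rmorphXn mulNr.
Qed.

End Evaluation.

(** * Independence of the split functions and triviality of the projections for k = 2 *)

Section TwoVariables.
Local Notation S2 := (mpoly.mpoly 2 F).
Context (ev : L -> S2).
Hypotheses (ev_lin : linear ev) (ev1 : ev 1 = 1)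
  (evM : forall f g, ev (f * g) = ev f * ev g)
  (ev_H : forall r : nat, ev (H r%:Z) = mesym 2 F r).
Local Notation x0 := ('X_(ord0) : S2).
Local Notation x1 := ('X_(ord_max) : S2).

HB.instance Definition _ := GRing.isLinear.Build F L S2 *:%R ev ev_lin.

(** In two variables e_r vanishes for r > 2, which leaves two terms of B_1 and, in [ev_B2], a mere
    multiplication by e_2. *)
Lemma ev_B1 f : ev (B 1 f) = (x0 + x1) * ev f + x0 * x1 * ev (theta 1 f).
Proof.
have [K HK] := theta_nil f.
have HK' k : (K.+2 <= k)%N -> theta k f = 0 by move=> /ltnW /ltnW; exact: HK.
rewrite (BE _ HK') linear_sum 2!big_ord_recl big1 => [|k _] /=; last first.
  by rewrite evM ev_H mesym_geqnE ?mul0r.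
rewrite !evM !ev_H theta0 addr0 mesym1E mesymnnE !big_ord_recl !big_ord0 addr0 mulr1.
by rewrite (_ : lift ord0 ord0 = ord_max) //; apply: val_inj.
Qed.

Lemma ev_B2 f : ev (B 2 f) = x0 * x1 * ev f.
Proof.
have [K HK] := theta_nil f.
have HK' k : (K.+1 <= k)%N -> theta k f = 0 by move=> /ltnW; exact: HK.
rewrite (BE _ HK') linear_sum big_ord_recl big1 => [|k _] /=; last first.
  by rewrite evM ev_H mesym_geqnE ?mul0r.
rewrite !evM !ev_H theta0 addr0 mesymnnE !big_ord_recl !big_ord0 mulr1.
by rewrite (_ : lift ord0 ord0 = ord_max) //; apply: val_inj.
Qed.

Lemma ev_D h j : exists r, ev (B11pow h j) = x0 ^+ (2 * h + j) + x1 * r.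
Proof.
elim: h j => [|h IH] j.
  elim: j => [|j [r IH]]; first by exists 0; rewrite ev1 mulr0 addr0.
  exists (ev (B1pow j) + x0 * r + x0 * ev (theta 1 (B1pow j))).
  rewrite [B11pow 0 _]B1powS ev_B1 [ev (B1pow j)]IH exprS; ring.
have [r IHr] := IH j.+2.
exists (r - mpoly.mpolyC 2 (q ^+ (1 + h + j)) * (x0 * ev (B11pow h j))).
rewrite D_S linearB linearZ /= -mul_mpolyC ev_B2 IHr.
by rewrite (_ : 2 * h + j.+2 = 2 * h.+1 + j)%N; [ring|lia].
Qed.

Lemma ev_iterB2 l f : ev (iter l (B 2) f) = x1 ^+ l * (x0 ^+ l * ev f).
Proof.
elim: l => [|l IH]; first by rewrite !mul1r.
by rewrite iterS ev_B2 IH !exprS; ring.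
Qed.

Definition leadm l p : 'X_{1..2} := [multinom (if i == ord0 then (l + p)%N else l) | i < 2].

(** By [ev_iterB2] and [ev_D] the evaluation is x1^l' times x0^(l'+2h+j) plus a multiple of
    x1^(l'+1). This makes the family triangular with respect to the power of x1. *)
Lemma mcoeff_ev l p l' h j : (l <= l')%N ->
  mcoeff (leadm l p) (ev (iter l' (B 2) (B11pow h j))) =
  ((l == l') && (p == 2 * h + j)%N)%:R.
Proof.
move=> ll'; have [r Er] := ev_D h j.
rewrite ev_iterB2 mcoeffXnM mnmE /=.
case: (ltngtP l l') ll' => // -> _.
rewrite mcoeffXnM mnmBE mnmE mulmnE mnm1E /= subn0 leq_addr Er mcoeffD.
rewrite mpolyXn mcoeffX -[x1]expr1 mcoeffXnM.
rewrite !(mnmBE, mulmnE, mnm1E, mnmE) /= ?mul1n ?subnn ?mul0n ?sub0n /= addr0.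
congr (nat_of_bool _)%:R; apply/eqP/eqP => [/mnmP/(_ ord0)|->].
  by rewrite !(mnmBE, mulmnE, mnm1E, mnmE) /= !mul1n subn0 addKn.
apply/mnmP => i; rewrite !(mnmBE, mulmnE, mnm1E, mnmE).
have [->|->] : i = ord0 \/ i = ord_max.
  by case: i => -[|[|//]] ?; [left|right]; apply: val_inj.
- by rewrite /= !mul1n subn0 addKn.
- by rewrite /= !mul0n mul1n subn0 subnn.
Qed.

Local Notation part21 l p := (nseq l 2%N ++ nseq p 1%N).
Context (C : seq nat -> L).
Hypothesis Csplit2 : forall l p,
  C (part21 l p) = iter l (B 2) (B11pow p./2 (odd p)).

Lemma kbounded2P la : kbounded 2 la -> exists l p, la = part21 l p.
Proof.
elim: la => [|a la IH]; first by exists 0%N, 0%N.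
rewrite /kbounded /is_part /= in_cons negb_or -!andbA => /and5P[srt a0 n0 a2 all2].
have [|l [p laE]] := IH.
  by rewrite /kbounded /is_part n0 (path_sorted srt).
case: a a0 a2 srt => [|[|[|a]]] // _ _; rewrite laE => srt; last by exists l.+1, p.
by case: l {laE} srt => [|l] //; exists 0%N, p.+1.
Qed.

Lemma kbounded2 l p : kbounded 2 (part21 l p).
Proof.
have srt1 n : path geq 1 (nseq n 1) by elim: n => //= n ->.
have srt2 n : path geq 2 (part21 n p).
  by elim: n => [|n IH]; [case: p => //= n|rewrite /= IH].
apply/andP; split; last by rewrite all_cat !all_nseq /= !orbT.
apply/andP; split; last by rewrite mem_cat !mem_nseq !andbF.
by case: l => [|l]; [case: p {srt2}|exact: srt2].
Qed.

(** Strong induction on the number of twos: the coefficient of [leadm l p] sees no partition with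
    more twos, and those with fewer already have coefficient zero. *)
Lemma C_free (d : seq (seq nat)) (g : seq nat -> F) : uniq d ->
  (forall la, la \in d -> kbounded 2 la) -> \sum_(la <- d) g la *: C la = 0 ->
  forall la, la \in d -> g la = 0.
Proof.
move=> ud kd g0.
suff gl0 l p : part21 l p \in d -> g (part21 l p) = 0.
  by move=> la lad; have [l [p laE]] := kbounded2P (kd _ lad); rewrite laE in lad *; apply: gl0.
elim/ltn_ind: l p => l IH p lad; set la := part21 l p in lad *.
have := congr1 (fun f => mcoeff (leadm l p) (ev f)) g0.
rewrite linear0 mcoeff0 linear_sum raddf_sum /= (bigD1_seq la) //= big1_seq ?addr0.
  rewrite linearZ mcoeffZ Csplit2 mcoeff_ev // eqxx (_ : (p == 2 * p./2 + odd p)%N) ?mulr1 //.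
  by rewrite mul2n addnC odd_double_half.
move=> mu /andP[mula mud]; rewrite linearZ mcoeffZ.
have [l' [p' muE]] := kbounded2P (kd _ mud); rewrite muE in mula mud *.
case: (ltnP l' l) => [lt|le]; first by rewrite IH // mul0r.
rewrite Csplit2 mcoeff_ev // (_ : 2 * p'./2 + odd p' = p')%N; last first.
  by rewrite mul2n addnC odd_double_half.
case: (l =P l') => [ll'|_]; last by rewrite mulr0.
case: (p =P p') => [pp'|_]; last by rewrite mulr0.
by rewrite /la ll' pp' eqxx in mula.
Qed.

Lemma lsum_C_inj c1 c2 : (forall la, la \in monalg.msupp c1 -> kbounded 2 la) ->
  (forall la, la \in monalg.msupp c2 -> kbounded 2 la) -> lsum c1 C = lsum c2 C ->
  forall (V : lmodType F) (X : seq nat -> V), lsum c1 X = lsum c2 X.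
Proof.
move=> k1 k2 E V X.
have s1 := fsubsetUl (monalg.msupp c1) (monalg.msupp c2).
have s2 := fsubsetUr (monalg.msupp c1) (monalg.msupp c2).
move: E; rewrite !(lsumEw _ s1) !(lsumEw _ s2) => /eqP; rewrite -subr_eq0 -sumrB => /eqP.
under eq_bigr => la _ do rewrite -scalerBl.
move=> /(C_free (fset_uniq _)) c0; rewrite big_seq [RHS]big_seq; apply: eq_bigr => la lad.
have /eqP : monalg.mcoeff la c1 - monalg.mcoeff la c2 = 0.
  apply: c0 lad => mu; rewrite in_fsetU => /orP[]; [exact: k1|exact: k2].
by rewrite subr_eq0 => /eqP ->.
Qed.

Context (coord : L -> {malg F[seq nat]}) (T : nat -> L -> L) (kf : seq nat -> L).
Hypotheses (Ccoord_exists : forall f,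
    (exists2 c, forall la, la \in monalg.msupp c -> kbounded 2 la & f = lsum c C) ->
    (forall la, la \in monalg.msupp (coord f) -> kbounded 2 la) /\ f = lsum (coord f) C)
  (TE : forall i f, T i f = lsum (coord f) (fun la => if head 0%N la == i then C la else 0))
  (kf0 : kf [::] = 1) (kf1 : forall a : nat, kf [:: a] = H a%:Z)
  (kfS : forall a b la, kf (a :: b :: la) = T a (B a%:Z (kf (b :: la)))).

(** By independence the chosen coordinates give the same projection as the evident two-term
    expansion of the argument. *)
Lemma T_two i la mu c : kbounded 2 la -> kbounded 2 mu ->
  T i (C la + c *: C mu) =
  (if head 0%N la == i then C la else 0) + c *: (if head 0%N mu == i then C mu else 0).
Proof.
move=> kla kmu; set f := C la + _.
pose g : {malg F[seq nat]} := << 1 *g la >> + << c *g mu >>.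
have gE (V : lmodType F) (X : seq nat -> V) : lsum g X = X la + c *: X mu.
  by rewrite lsumD !lsumU scale1r.
have gk nu : nu \in monalg.msupp g -> kbounded 2 nu.
  move=> /(fsubsetP (monalg.msuppD_le _ _)); rewrite in_fsetU.
  by case/orP => /(fsubsetP monalg.msuppU_le); rewrite in_fset1 => /eqP ->.
have [] := @Ccoord_exists f; first by exists g => //; rewrite gE.
move=> ck fE; rewrite TE -(lsum_C_inj gk ck); first by rewrite gE.
by rewrite -fE gE.
Qed.

Lemma T_one i la : kbounded 2 la -> head 0%N la = i -> T i (C la) = C la.
Proof.
move=> kla hla; have := T_two i 0 kla kla.
by rewrite !scale0r !addr0 hla eqxx.
Qed.

Lemma kf_C l p : kf (part21 l p) = C (part21 l p).
Proof.
elim: l => [|l IH]; last first.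
  have step : B 2 (C (part21 l p)) = C (part21 l.+1 p) by rewrite !Csplit2.
  (* A single row follows the separate rule s_(a) = h_a, which agrees with B_a 1. *)
  case E: (part21 l p) => [|b la].
    have [-> ->] : l = 0%N /\ p = 0%N by case: l {IH step} E => //; case: p.
    by rewrite kf1 (Csplit2 1 0) -[RHS]/(B 2 1) B_one.
  rewrite -[nseq l.+1 2%N ++ _]/(2%N :: part21 l p) E kfS -E IH step T_one //.
  exact: (kbounded2 l.+1 p).
elim: p => [|p IH]; first by rewrite kf0 (Csplit2 0 0).
case: p IH => [|p] IH; first by rewrite kf1 (Csplit2 0 1) -[RHS]/(B 1 1) B_one.
rewrite -[LHS]/(kf [:: 1, 1 & nseq p 1]%N) kfS -[1%N :: nseq p 1%N]/(part21 0 p.+1) IH.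
rewrite (Csplit2 0 p.+1) -[iter 0 _ _]/(B11pow (uphalf p) (odd p.+1)) uphalf_half.
have C2 : C (part21 0 p.+2) = B11pow p./2.+1 (odd p) by rewrite Csplit2 /= negbK.
case op: (odd p) C2 => C2 /=; rewrite op /=.
  by rewrite add1n B1_D -[B11pow _ 1]C2 T_one // (kbounded2 0 p.+2).
(* For even length an extra multiple of C_(2,1^p) appears; its first part is 2, so T_1 removes
   it. *)
rewrite add0n B1_D1 -[B11pow _.+1 0]C2.
have -> : B 2 (B11pow p./2 0) = C (part21 1 p) by rewrite Csplit2 op.
by rewrite T_two ?(kbounded2 0 p.+2) ?(kbounded2 1 p) //= scaler0 addr0.
Qed.

End TwoVariables.

End VertexOperators.

(** * The operators B_nu for the segments (a) and (1,1) *)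

Section BpartSmall.
Context (F : fieldType) (q : F) (L : lmodType F) (B : int -> L -> L) (f : L).

Definition Braise nu := \sum_(A : {set 'I_(size nu) * 'I_(size nu)} | [forall p in A, p.1 < p.2]%N)
    (- q) ^+ #|A| *: foldr B f (raise A).

Lemma Braise1 a : Braise [:: a] = B a%:Z f.
Proof.
rewrite /Braise (big_pred1 set0) => [|A].
  rewrite cards0 expr0 scale1r /raise /image_mem enum_ordSl.
  rewrite (_ : enum 'I_0 = [::]) /=; last by apply/eqP; rewrite -size_eq0 size_enum_ord.
  have e0 (P : 'I_1 * 'I_1 -> bool) : #|[set p in set0 | P p]| = 0%N.
    by apply: eq_card0 => p; rewrite !inE.
  by rewrite !e0 /= addr0 subr0.
apply/forall_inP/eqP => [H|->]; last by move=> p; rewrite inE.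
by apply/setP => -[i j]; rewrite inE; apply/negP => /H; rewrite !ord1.
Qed.

(** Only the pair (0, 1) is increasing, so the sum has two terms: the empty set and the single
    raising operator. *)
Lemma Braise11 : Braise [:: 1%N; 1%N] = B 1 (B 1 f) - q *: B 2 (B 0 f).
Proof.
pose i0 : 'I_2 := ord0; pose i1 : 'I_2 := ord_max.
have raiseE (A : {set 'I_2 * 'I_2}) : raise (nu := [:: 1%N; 1%N]) A =
    [:: 1%:Z + #|[set p in A | p.1 == i0]|%:Z - #|[set p in A | p.2 == i0]|%:Z;
        1%:Z + #|[set p in A | p.1 == i1]|%:Z - #|[set p in A | p.2 == i1]|%:Z].
  rewrite /raise /image_mem !enum_ordSl.
  rewrite (_ : enum 'I_0 = [::]) /=; last by apply/eqP; rewrite -size_eq0 size_enum_ord.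
  by rewrite (_ : lift ord0 ord0 = i1) //; apply: val_inj.
pose A1 : {set 'I_2 * 'I_2} := [set (i0, i1)].
have card_A1 (P : 'I_2 * 'I_2 -> bool) : #|[set p in A1 | P p]| = P (i0, i1) :> nat.
  rewrite (_ : [set p in A1 | P p] = if P (i0, i1) then A1 else set0).
    by case: (P _); rewrite ?cards1 ?cards0.
  apply/setP => p; rewrite !inE; case: (p =P (i0, i1)) => [->|pN] /=.
    by case: (P _); rewrite ?inE.
  by case: (P (i0, i1)); rewrite !inE //; apply/esym/eqP.
have card_0 (P : 'I_2 * 'I_2 -> bool) : #|[set p in set0 | P p]| = 0%N.
  by apply: eq_card0 => p; rewrite !inE.
rewrite /Braise (bigD1 set0) /=; last by apply/forall_inP => p; rewrite inE.
rewrite (bigD1 A1) /=; last first.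
  apply/andP; split; last by rewrite -cards_eq0 cards1.
  by apply/forall_inP => p; rewrite inE => /eqP ->.
rewrite big1 => [|A /andP[/andP[/forall_inP HA A0] A1N]]; last first.
  case/negP: A1N; have [p pA] := set0Pn _ A0.
  have Ap p' : p' \in A -> p' = (i0, i1).
    case: p' => -[[|[|//]] li] [[|[|//]] lj] /HA //= _.
    by congr pair; apply: val_inj.
  rewrite eqEsubset; apply/andP; split; apply/subsetP => p'; rewrite ?inE.
    by move=> /Ap ->.
  by move=> /eqP ->; rewrite -(Ap p pA).
rewrite !raiseE cards0 cards1 !card_0 !card_A1 expr0 expr1 scale1r scaleNr addr0.
by rewrite /= [X in _ + X]addr0.
Qed.

End BpartSmall.

(** * The 2-split: each 2 alone, the ones in pairs, and possibly a last single 1 *)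

Lemma split_size_eq k la v : (v <= size la)%N -> (hook_length (take v la) <= k)%N ->
  (forall j, (j <= size la)%N -> (hook_length (take j la) <= k)%N -> (j <= v)%N) ->
  split_size k la = v.
Proof.
move=> vla hv vmax; apply/eqP; rewrite eqn_leq; apply/andP; split.
  by apply/bigmax_leqP => j; apply: vmax; rewrite -ltnS.
have vlt : (v < (size la).+1)%N by [].
exact: (@leq_bigmax_cond _ (fun j : 'I_(size la).+1 => hook_length (take j la) <= k)%N
  (fun j => j : nat) (Ordinal vlt)).
Qed.

Lemma split_size2 la : split_size 2 (2 :: la)%N = 1%N.
Proof.
apply: split_size_eq => // [|[|[|j]] //]; first by rewrite /= take0.
rewrite /hook_length /= size_take_min; lia.
Qed.

Lemma split_size11 la : split_size 2 (1 :: 1 :: la)%N = 2%N.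
Proof.
apply: split_size_eq => // [|[|[|[|j]]] //]; first by rewrite /= take0.
rewrite /hook_length /= size_take_min; lia.
Qed.

Lemma split_size1 : split_size 2 [:: 1%N] = 1%N.
Proof. by apply: split_size_eq => // -[|[|j]]. Qed.

Lemma lsum_cond (F : fieldType) (K : choiceType) (V : lmodType F) (c : {malg F[K]})
  (P : pred K) (X : K -> V) :
  \sum_(k <- monalg.msupp c | P k) monalg.mcoeff k c *: X k =
  lsum c (fun k => if P k then X k else 0).
Proof.
rewrite /lsum big_mkcond; apply: eq_bigr => k _.
by case: (P k); rewrite ?scaler0.
Qed.

Section Ksplit.
Context (F : fieldType) (q : F) (L : lmodType F) (B : int -> L -> L) (D : nat -> nat -> L).
Hypotheses (D1 : D 0 1 = B 1 (D 0 0))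
  (DS : forall h e, D h.+1 e = B 1 (B 1 (D h e)) - q *: B 2 (B 0 (D h e))).
Local Notation step := (fun nu f => Braise q B f nu).

Lemma foldr_ksplit1 n p : (p <= n)%N ->
  foldr step (D 0 0) (ksplit_rec n 2 (nseq p 1)) = D p./2 (odd p).
Proof.
elim/ltn_ind: p n => -[|[|p]] IH [|n] // pn.
  by rewrite /= split_size1 /= Braise1; case: n {pn}.
rewrite [ksplit_rec _ _ _]/= split_size11 /= drop0 IH //; last exact: ltnW.
by rewrite take0 Braise11 negbK -DS.
Qed.

Lemma foldr_ksplit l p :
  foldr step (D 0 0) (ksplit 2 (nseq l 2 ++ nseq p 1)) = iter l (B 2) (D p./2 (odd p)).
Proof.
rewrite /ksplit; elim: l => [|l IH]; first by rewrite foldr_ksplit1 // size_nseq.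
by rewrite /= split_size2 /= drop0 take0 Braise1 IH.
Qed.

End Ksplit.

(** * Instantiation at symmetric functions and the form of the 2-Schur functions *)

Section TwoSchur.
Context (F : fieldType) (F0 : [pchar F] =i pred0) (q : F).
Local Notation Lam := (Sym F).
Local Notation H := (zext (@h_ F)).
Local Notation th := (theta q (@h_ F) (@e_ F) (@perp F)).

Lemma Bop_def a (f : Lam) : Bop q a f = \sum_(j < (xdeg f).+1) q ^+ j *:
     \sum_(r < (xdeg (perp (h_ F j) f)).+1)
        (-1) ^+ r *: (H (a + j%:Z + r%:Z) * perp (e_ F r) (perp (h_ F j) f)).
Proof. by []. Qed.

Lemma h_0 : h_ F 0 = 1. Proof. by []. Qed.
Lemma e_0 : e_ F 0 = 1. Proof. by []. Qed.

Lemma h_S n : h_ F n.+1 = n.+1%:R^-1 *: \sum_(i < n.+1) 1 ^+ i *: (psum F i * h_ F (n - i)%N).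
Proof. exact: newton_rec. Qed.

Lemma e_S n : e_ F n.+1 = n.+1%:R^-1 *: \sum_(i < n.+1) (-1) ^+ i *: (psum F i * e_ F (n - i)%N).
Proof. exact: newton_rec. Qed.

Let pl := perp_linear F0.
Let pll := perp_linearl F0.
Let pM := perpM F0.
Let p1 := perp1 F0.
Let pp1 := @perp_psum1 F F0.
Let ppp := perp_psumM F0.
Let sind := @Sym_ind F.
Let peh := @perp_eh_eq0 F.

Let thl : forall k, linear (th k) := fun k => pl (vseq q (@h_ F) (@e_ F) k).
Let th0 : forall f, th 0 f = f := theta0 F0 q p1 h_0 e_0 h_S e_S.
Let thM := thetaM F0 q pl pll pM p1 sind pp1 ppp h_0 e_0 h_S e_S.
Let thC := thetaC q (@h_ F) (@e_ F) pM.
Let thH := theta_zext F0 q pl pll pM p1 pp1 ppp h_0 e_0 h_S e_S.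
Let thB := fun a f K => @BE _ _ _ _ _ _ _ _ pll pM h_0 peh Bop_def a f K.

Let thN (f : Lam) : exists K, forall k, (K <= k)%N -> th k f = 0.
Proof. by exists (xdeg f).+1 => k; exact: (theta_eq0 q pll peh). Qed.

Let H0 : H 0 = 1. Proof. by []. Qed.
Let Hneg n : H (Negz n) = 0. Proof. by []. Qed.

Section Eval.
Context (N : nat).
(** Applying omega first sends h_r to the elementary polynomial in N variables, as the clique
    recursion requires. *)
Definition evw (f : Lam) := evalx N (omega f).

Lemma evw_lin : linear evw.
Proof.
move=> c f g; rewrite /evw.
have -> : omega (c *: f + g) = c *: omega f + omega g by exact: (linearP (@omega F)).
exact: (linearP (@evalx F N)).
Qed.

Lemma evw1 : evw 1 = 1.
Proof.
rewrite /evw; have -> : omega (1 : Lam) = 1 by exact: (rmorph1 (@omega F)).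
exact: (rmorph1 (@evalx F N)).
Qed.

Lemma evwM f g : evw (f * g) = evw f * evw g.
Proof.
rewrite /evw; have -> : omega (f * g) = omega f * omega g by exact: (rmorphM (@omega F)).
exact: (rmorphM (@evalx F N)).
Qed.

Lemma evwH (r : nat) : evw (H r%:Z) = mesym N F r.
Proof. by rewrite /evw [H _]/(h_ F r) omega_h evalx_e. Qed.
End Eval.

Lemma Csplit2 l p : Csplit q 2 (nseq l 2 ++ nseq p 1) =
  iter l (Bop q 2) (B11pow q (Bop q) p./2 (odd p)).
Proof.
have E : Csplit q 2 (nseq l 2%N ++ nseq p 1%N) = foldr (fun nu f => Braise q (Bop q) f nu)
  (B11pow q (Bop q) 0 0) (ksplit 2 (nseq l 2%N ++ nseq p 1%N)) by exact: erefl.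
apply: (etrans E); apply: foldr_ksplit => [|h j]; first exact: erefl.
exact: (esym (B11_D H0 Hneg thl th0 thM thC thH thN thB F0 h j)).
Qed.

Lemma Ccoord_exists (f : Lam) :
    (exists2 c : {malg F[seq nat]}, forall la, la \in monalg.msupp c -> kbounded 2 la &
        f = lsum c (Csplit q 2)) ->
  (forall la, la \in monalg.msupp (kcoord q 2 f) -> kbounded 2 la) /\
    f = lsum (kcoord q 2 f) (Csplit q 2).
Proof.
by move=> [c ck fE]; apply: (epsilon_spec (inhabits 0) (is_kcoord q 2 f)); exists c.
Qed.

Lemma TE i (f : Lam) : Tproj q 2 i f =
  lsum (kcoord q 2 f) (fun la => if head 0%N la == i then Csplit q 2 la else 0).
Proof.
exact: lsum_cond.
Qed.

Lemma kschur2 l p : kschur q 2 (nseq l 2 ++ nseq p 1) =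
  iter l (Bop q 2) (B11pow q (Bop q) p./2 (odd p)).
Proof.
rewrite -Csplit2; apply: (kf_C H0 Hneg thl th0 thM thC thH thN thB F0 (@evw_lin 2) (@evw1 2)
  (@evwM 2) (@evwH 2) Csplit2 Ccoord_exists TE) => //.
Qed.

Hypotheses (q_neq0 : q != 0) (q_gen : forall n, 1 - q ^+ n.+1 != 0).

Lemma evw_domino_eval N l h j :
  domino_eval (@mpoly.mpolyC N F q) (fun i => mpolyX F U_(i)) l h j =
  (@mpoly.mpolyC N F q) ^+ (l * h + 'C(l, 2)) * evw N (iter l (Bop q 2) (B11pow q (Bop q) h j)).
Proof.
exact: (ev_domino_eval H0 Hneg thl th0 thM thC thH thN thB F0 (@evw_lin N) (@evw1 N)
  (@evwM N) (@evwH N) q_neq0 q_gen).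
Qed.

End TwoSchur.

(** * The involution omega, genericity of q, exponents, and the theorem *)

Lemma involution_ext (F : fieldType) (L : comAlgType F) (p : nat -> L) (T : L -> L) :
  (forall P : L -> Prop, (forall c f g, P f -> P g -> P (c *: f + g)) ->
     P 1 -> (forall i f, P f -> P (p i * f)) -> forall f, P f) ->
  linear T -> T 1 = 1 -> (forall f g, T (f * g) = T f * T g) ->
  (forall i, T (p i) = (-1) ^+ i *: p i) -> forall f, T (T f) = f.
Proof.
move=> ind lin T1 TM Tp; apply: ind => [c f g Hf Hg||i f Hf].
- by rewrite !lin Hf Hg.
- by rewrite !T1.
have TZ c f' : T (c *: f') = c *: T f'.
  have := lin c f' 0; rewrite addr0 => ->.
  by have := lin (-1) 1 1; rewrite !scaleN1r !addNr => ->; rewrite addr0.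
by rewrite !TM Hf Tp TZ Tp scalerA -exprD addnn -mul2n exprM sqrrN !expr1n scale1r.
Qed.

Lemma omegaK (F : fieldType) (f : Sym F) : omega (omega f) = f.
Proof.
apply: (@involution_ext F (Sym F) (psum F) (@omega F) (@Sym_ind F)).
- exact: (linearP (@omega F)).
- exact: (rmorph1 (@omega F)).
- exact: (rmorphM (@omega F)).
exact: omega_psum.
Qed.

Lemma qvar_neq0 : qvar != 0.
Proof. by rewrite tofrac_eq0 polyX_eq0. Qed.

Lemma qvar_gen n : 1 - qvar ^+ n.+1 != 0.
Proof.
rewrite /qvar -tofrac1 -tofracXn -tofracB tofrac_eq0 subr_eq0 eq_sym.
apply/eqP => /(congr1 (fun p : {poly rat} => size p)).
by rewrite size_polyXn size_poly1.
Qed.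

Lemma sum_exponent l h : (\sum_(1 <= i < l.+1) (l + h - i) = l * h + 'C(l, 2))%N.
Proof.
rewrite big_add1 big_mkord (reindex_inj rev_ord_inj) /=.
rewrite (eq_bigr (fun i : 'I_l => h + i)%N) => [|i _].
  by rewrite big_split sum_nat_const card_ord -bin2_sum big_mkord.
by have := ltn_ord i; lia.
Qed.

(** The witness is q^M omega f; its image under omega is q^M f because omega is an involution. *)
Lemma LLT_symmetric (F : fieldType) (q : F) d (lam : d.-tuple skew_diagram) (M : nat) (f : Sym F) :
  (forall N, LLT q lam N = (@mpoly.mpolyC N F q) ^+ M * evw N f) ->
  exists2 G : Sym F, is_LLT q lam G & omega G = q ^+ M *: f.
Proof.
move=> E; exists (q ^+ M *: omega f) => [N|].
  have -> : evalx N (q ^+ M *: omega f) = q ^+ M *: evalx N (omega f).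
    exact: (linearZ_LR (@evalx F N)).
  by rewrite E -mul_mpolyC rmorphXn.
have -> : omega (q ^+ M *: omega f) = q ^+ M *: omega (omega f).
  exact: (linearZ_LR (@omega F)).
by rewrite (omegaK f).
Qed.

Theorem theorem4p6 (eta0 eta1 : skew_diagram)
    (h0 : horizontal_domino01 eta0) (h1 : vertical_domino01 eta1)
    (m : nat) (hm : (1 <= m)%N) (a : m.-tuple bool) :
  let l := count_mem true a in
  let eta := [tuple (if tnth a i then eta1 else eta0) | i < m] in
  (forall n : nat, n = (2 * m)%N ->
     exists2 G : Sym Qq, is_LLT qvar eta G &
       omega G = qvar ^+ (\sum_(1 <= i < l.+1) (m - i))%N
                 *: kschur qvar 2 (nseq l 2%N ++ nseq (n - 2 * l) 1%N))
  /\
  (forall (n : nat) (b : skew_diagram), n = (2 * m + 1)%N -> single_cell0 b ->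
     exists2 G : Sym Qq, is_LLT qvar [tuple of rcons eta b] G &
       omega G = qvar ^+ (\sum_(1 <= i < l.+1) (m - i + 1))%N
                 *: kschur qvar 2 (nseq l 2%N ++ nseq (n - 2 * l) 1%N)).
Proof.
move=> l eta; pose h := count_mem false a.
have lh : m = (l + h)%N.
  rewrite -(size_tuple a) -(count_predC (pred1 true) a); congr (_ + _)%N.
  by apply: eq_count => -[].
have aE : mkseq (nth false a) m = a.
  by rewrite -{2}(size_tuple a); exact: mkseq_nth.
have two N : 2%:R != 0 :> mpoly.mpoly N Qq by exact: two_S pchar_Qq N.
have eta_domino (i : 'I_m) : if nth false a i then vertical_domino01 (tnth eta i)
    else horizontal_domino01 (tnth eta i).
  by rewrite tnth_mktuple -tnth_nth; case: (tnth a i).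
split=> [n nE|n b nE b0]; apply: LLT_symmetric => N.
  rewrite (LLT_even (s := nth false a)) // aE dominoes_domino_eval; last exact: two.
  rewrite (evw_domino_eval pchar_Qq qvar_neq0 qvar_gen) kschur2; last exact: pchar_Qq.
  (* The remaining ones number 2h, which is B_11 applied h times, one for each horizontal domino. *)
  have -> : (n - 2 * l = h.*2)%N by rewrite nE lh -mul2n; lia.
  by rewrite half_double odd_double [in RHS]lh sum_exponent.
have etaE i : tnth [tuple of rcons eta b] i = nth b (rcons eta b) i by exact: tnth_nth.
rewrite (LLT_odd (s := nth false a)).
- rewrite aE left_op_dominoes_domino_eval; last exact: two.
  rewrite (evw_domino_eval pchar_Qq qvar_neq0 qvar_gen) kschur2; last exact: pchar_Qq.
  have -> : (n - 2 * l = h.*2.+1)%N by rewrite nE lh -mul2n; lia.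
  rewrite /= uphalf_double odd_double mulrA -exprD; congr (_ ^+ _ * _).
  (* The additional l in the exponent is the q^l produced by the single cell passing the vertical
     dominoes. *)
  have -> : (\sum_(1 <= i < l.+1) (m - i + 1) = l * h + 'C(l, 2) + l)%N.
    rewrite big_split -sum_exponent -lh; congr (_ + _)%N.
    by rewrite sum_nat_const_nat muln1 subSS subn0.
  by rewrite addnC.
- move=> i im; rewrite etaE nth_rcons (size_tuple eta) im.
  by have := eta_domino (Ordinal im); rewrite (tnth_nth b).
by rewrite etaE nth_rcons (size_tuple eta) ltnn eqxx.
Qed.
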